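(* Let $(\sigma,\eta,\tilde\eta,\rho)$ be royal tetra-interpolation data of type $(n,k)$. The following two statements are equivalent. (i) The royal tetra-interpolation problem with data $(\sigma,\eta,\tilde\eta,\rho)$ admits a solution $x$ (a rational $\overline{\mathcal E}$-inner function of degree $n$ satisfying the interpolation conditions) such that $x(\overline{\mathbb D})\nsubseteq \mathcal R_{\overline{\mathcal E}}$. (ii) The Blaschke interpolation problem with data $(\sigma,\eta,\rho)$ of type $(n,k)$ is solvable and there exist $x_1^\circ,x_2^\circ,x_3^\circ\in\mathbb C$ such that $$|x_3^\circ|=1,\quad |x_1^\circ|<1,\quad |x_2^\circ|<1,\quad x_1^\circ=\overline{x_2^\circ}\,x_3^\circ,$$ and $$\frac{x_3^\circ c(\sigma_j)+x_2^\circ d(\sigma_j)}{x_1^\circ c(\sigma_j)+d(\sigma_j)}=\tilde\eta_j\quad\text{for } j=1,\dots,n,$$ where $a,b,c,d$ are the polynomials in any fixed normalized linear fractional parametrization $\varphi=\dfrac{a\zeta+b}{c\zeta+d}$ of the solutions of the Blaschke interpolation problem with data $(\sigma,\eta,\rho)$.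
   Context: $\mathbb D$ is the open unit disc in $\mathbb C$, $\overline{\mathbb D}$ its closure, $\mathbb T$ the unit circle. Closed tetrablock: $\overline{\mathcal E}=\{(x_1,x_2,x_3)\in\mathbb C^3: 1-x_1z-x_2w+x_3zw\neq 0 \text{ whenever } |z|<1,|w|<1\}$. Its distinguished boundary (smallest closed boundary) is $b\overline{\mathcal E}=\{x\in\mathbb C^3: x_1=\overline{x_2}x_3,\ |x_3|=1,\ |x_2|\le 1\}$. Royal variety: $\mathcal R_{\overline{\mathcal E}}=\{(x_1,x_2,x_3)\in\overline{\mathcal E}: x_3=x_1x_2\}$. A rational $\overline{\mathcal E}$-inner (or tetra-inner) function is an analytic map $x=(x_1,x_2,x_3):\mathbb D\to\overline{\mathcal E}$ with rational components such that $\lim_{r\uparrow1}x(r\lambda)\in b\overline{\mathcal E}$ for almost all $\lambda\in\mathbb T$; it extends continuously to $\overline{\mathbb D}$. Its degree is the topological degree of $x|_{\mathbb T}:\mathbb T\to b\overline{\mathcal E}$ (where $\pi_1(b\overline{\mathcal E})\cong\mathbb Z$); it equals the degree of the finite Blaschke product $x_3$. Phasar derivative: if $f$ is a differentiable function on $\mathbb T$, nonvanishing near $z=e^{i\theta}$, $Af(z)$ denotes the derivative with respect to $\theta$ of $\arg f(e^{i\theta})$ at $z$. Blaschke interpolation data of type $(n,k)$, $n\ge1$, $0\le k\le n$: a triple $(\sigma,\eta,\rho)$ where $\sigma=(\sigma_1,\dots,\sigma_n)$ consists of distinct points with $\sigma_j\in\mathbb T$ for $j\le k$ and $\sigma_j\in\mathbb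 D$ for $j>k$; $\eta=(\eta_1,\dots,\eta_n)$ with $\eta_j\in\mathbb T$ for $j\le k$ and $\eta_j\in\mathbb D$ for $j>k$; $\rho=(\rho_1,\dots,\rho_k)$ with $\rho_j>0$. Royal tetra-interpolation data of type $(n,k)$: a four-tuple $(\sigma,\eta,\tilde\eta,\rho)$ where $(\sigma,\eta,\rho)$ is Blaschke interpolation data of type $(n,k)$ and $\tilde\eta=(\tilde\eta_1,\dots,\tilde\eta_n)$ with $\tilde\eta_j\in\mathbb T$ for $j\le k$ and $\tilde\eta_j\in\mathbb D$ for $j>k$. Blaschke interpolation problem: find all rational inner functions $\varphi$ on $\mathbb D$ (finite Blaschke products) of degree $n$ with $\varphi(\sigma_j)=\eta_j$ for $j=1,\dots,n$ and $A\varphi(\sigma_j)=\rho_j$ for $j=1,\dots,k$. It is solvable if such a $\varphi$ exists. Royal tetra-interpolation problem: find all rational $\overline{\mathcal E}$-inner functions $x=(x_1,x_2,x_3)$ of degree $n$ with $x(\sigma_j)=(\eta_j,\tilde\eta_j,\eta_j\tilde\eta_j)$ for $j=1,\dots,n$ and $Ax_1(\sigma_j)=\rho_j$ for $j=1,\dots,k$. Normalized linear fractional parametrization of the solutions of a solvable Blaschke interpolation problem: an expression $\varphi=\frac{a\zeta+b}{c\zeta+d}$ such that (1) $a,b,c,d$ are polynomials of degree at most $n$; (2) for all but at most $k$ values of $\zeta\in\mathbb T$ the function $\varphi(\lambda)=\frac{a(\lambda)\zeta+b(\lambda)}{c(\lambda)\zeta+d(\lambda)}$ is a solution of the problem; (3)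 for some $\tau\in\mathbb T\setminus\{\sigma_1,\dots,\sigma_k\}$, $\begin{bmatrix}a(\tau)&b(\tau)\\ c(\tau)&d(\tau)\end{bmatrix}=\begin{bmatrix}1&0\\0&1\end{bmatrix}$; (4) every solution $\varphi$ of the problem has this form for some $\zeta\in\mathbb T$. Every solvable Blaschke interpolation problem has a normalized linear fractional parametrization. *)

(* Defs.v *)
From HB Require Import structures.
From mathcomp Require Import all_boot all_order all_algebra complex.
From mathcomp Require Import all_classical all_reals all_analysis.

Set Implicit Arguments.
Unset Strict Implicit.
Unset Printing Implicit Defensive.

Import Order.TTheory GRing.Theory Num.Theory numFieldNormedType.Exports.

Local Open Scope classical_set_scope.
Local Open Scope ring_scope.

(* The usual topology and norm of the field R[i]. *)
HB.instance Definition _ (R : rcfType) := NormedModule.copy R[i] R[i]^o.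

Section Tetrablock.
Variable R : realType.
Local Notation C := R[i].

Definition expi (t : R) : C := (cos t +i* sin t)%C.

Definition disc : set C := [set z | `|z| < 1].
Definition closed_disc : set C := [set z | `|z| <= 1].
Definition unit_circle : set C := [set z | `|z| = 1].

(* Periodicity makes this equivalent to "almost everywhere for arc length". *)
Definition ae_circle (P : C -> Prop) : Prop :=
  {ae lebesgue_measure, forall t : R, P (expi t)}.

(* A point (x1, x2, x3) of C^3 is encoded as ((x1, x2), x3). *)
Definition closed_tetrablock : set (C * C * C) :=
  [set x | forall z w : C, `|z| < 1 -> `|w| < 1 ->
    1 - x.1.1 * z - x.1.2 * w + x.2 * z * w != 0].

Definition tetrablock_boundary : set (C * C * C) :=
  [set x | [/\ x.1.1 = x.1.2^* * x.2, `|x.2| = 1 & `|x.1.2| <= 1]].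

Definition royal_variety : set (C * C * C) :=
  [set x | closed_tetrablock x /\ x.2 = x.1.1 * x.1.2].

(* A rational function is analytic on the disc iff it is a quotient of
   polynomials whose denominator has no zero there. *)
Definition rational_analytic (f : C -> C) : Prop :=
  exists p q : {poly C},
    forall z, disc z -> q.[z] != 0 /\ f z = p.[z] / q.[z].

Definition rational_degree (f : C -> C) (n : nat) : Prop :=
  exists p q : {poly C},
    [/\ coprimep p q,
        forall z, disc z -> q.[z] != 0 /\ f z = p.[z] / q.[z] &
        maxn (size p).-1 (size q).-1 = n].

(* Inner functions are identified with their continuous extensions to the
   closed disc; their values outside the closed disc are irrelevant. *)
Definition rational_inner (f : C -> C) : Prop :=
  [/\ rational_analytic f,
      forall z, disc z -> `|f z| <= 1,
      ae_circle (fun l => exists2 y : C, `|y| = 1 &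
        f (r%:C%C * l) @[r --> (1 : R)^'-] --> y) &
      {within closed_disc, continuous f}].

Definition tetra_inner (x : C -> C * C * C) : Prop :=
  [/\ [/\ rational_analytic (fun z => (x z).1.1),
          rational_analytic (fun z => (x z).1.2) &
          rational_analytic (fun z => (x z).2)],
      forall z, disc z -> closed_tetrablock (x z),
      ae_circle (fun l => exists2 y, tetrablock_boundary y &
        x (r%:C%C * l) @[r --> (1 : R)^'-] --> y) &
      {within closed_disc, continuous x}].

(* Topological degree: the distinguished boundary is a closed disc times a
   circle, its fundamental group is generated by the loop l |-> (0, 0, l), and
   x restricted to the circle is required to be freely homotopic, inside the
   distinguished boundary, to the n-th power of that loop. *)
Definition tetra_degree (x : C -> C * C * C) (n : nat) : Prop :=
  exists H : R * C -> C * C * C,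
    [/\ {within [set` `[0, 1]] `*` unit_circle, continuous H},
        forall s l, 0 <= s <= 1 -> unit_circle l ->
          tetrablock_boundary (H (s, l)),
        forall l, unit_circle l -> H (0, l) = x l &
        forall l, unit_circle l -> H (1, l) = (0, 0, l ^+ n)].

(* r is the derivative of arg f(e^{it}) at e^{it} = z: u is a branch of the
   argument of t |-> f(e^{it}) near t0.  Differentiability of u at t0 forces u
   to agree near t0 with the continuous branch having the same value at t0. *)
Definition is_phasar_derivative (f : C -> C) (z : C) (r : R) : Prop :=
  exists (t0 : R) (u : R -> R),
    [/\ expi t0 = z,
        \forall t \near t0, f (expi t) != 0 /\
          f (expi t) = `|f (expi t)| * expi (u t) &
        is_derive t0 1 u r].

Section Interpolation.
Variables (n k : nat) (hkn : (k <= n)%N).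
Variables (sigma eta etat : 'I_n -> C) (rho : 'I_k -> R).

Definition blaschke_data : Prop :=
  [/\ (0 < n)%N, injective sigma,
      forall j : 'I_n, if (j < k)%N then `|sigma j| = 1 else `|sigma j| < 1,
      forall j : 'I_n, if (j < k)%N then `|eta j| = 1 else `|eta j| < 1 &
      forall j : 'I_k, 0 < rho j].

Definition royal_data : Prop :=
  blaschke_data /\
  forall j : 'I_n, if (j < k)%N then `|etat j| = 1 else `|etat j| < 1.

Definition blaschke_solution (f : C -> C) : Prop :=
  [/\ rational_inner f, rational_degree f n,
      forall j, f (sigma j) = eta j &
      forall j : 'I_k,
        is_phasar_derivative f (sigma (widen_ord hkn j)) (rho j)].

Definition blaschke_solvable : Prop := exists f, blaschke_solution f.

Definition royal_solution (x : C -> C * C * C) : Prop :=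
  [/\ tetra_inner x, tetra_degree x n,
      forall j, x (sigma j) = (eta j, etat j, eta j * etat j) &
      forall j : 'I_k,
        is_phasar_derivative (fun z => (x z).1.1)
          (sigma (widen_ord hkn j)) (rho j)].

Definition lin_frac (a b c d : {poly C}) (zeta z : C) : C :=
  (a.[z] * zeta + b.[z]) / (c.[z] * zeta + d.[z]).

(* The pointwise quotient lin_frac has junk values where its denominator
   vanishes.  This is harmless: numerator and denominator have degree at most
   n, so they are coprime as soon as the quotient has degree n, and then the
   denominator has no zero in the closed disc when the quotient is inner. *)
Definition normalized_parametrization (a b c d : {poly C}) : Prop :=
  [/\ [/\ (size a <= n.+1)%N, (size b <= n.+1)%N,
          (size c <= n.+1)%N & (size d <= n.+1)%N],
      exists2 E : seq C, (size E <= k)%N &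
        forall zeta, unit_circle zeta -> zeta \notin E ->
          blaschke_solution (lin_frac a b c d zeta),
      exists tau, [/\ unit_circle tau,
        forall j : 'I_k, tau != sigma (widen_ord hkn j) &
        [/\ a.[tau] = 1, b.[tau] = 0, c.[tau] = 0 & d.[tau] = 1]] &
      forall f, blaschke_solution f ->
        exists2 zeta, unit_circle zeta &
          forall z, closed_disc z -> f z = lin_frac a b c d zeta z].

End Interpolation.

End Tetrablock.

(* Main.v *)
(* A rational tetra-inner function of degree n has the form
     (kappa rev E / q, E / q, kappa rev q / q),
   where |kappa| = 1, q has no zero in the closed disc, rev is the reversal of
   polynomials of degree at most n, and |E| <= |q| on the circle.  For |w| = 1
   the function (w x3 - x1) / (w x2 - 1) is the quotient of -w kappa rev Q by
   Q := w E - q, hence a Blaschke product of degree n unless Q vanishes in the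
   closed disc, which happens for finitely many w only; it solves the Blaschke
   problem because x maps the nodes into the royal variety.  Comparing it with
   the given parametrization, normalized at tau, yields
     x3(tau) c + x2(tau) d = E / q(tau)  and  x1(tau) c + d = q / q(tau),
   which is (ii).  The point x(tau) is not royal because q rev q - E rev E,
   which has degree at most 2n, already has 2n zeros at the nodes and their
   reflections (nodes on the circle are double zeros, as |q|^2 - |E|^2 >= 0
   there).  Conversely, a parametrization satisfies
     a = tau^(-n) rev d,  b = tau^(-n) rev c,  |c| <= |d| on the closed disc,
   and q := x1 c + d, E := x3 c + x2 d, kappa := x3 tau^(-n) define a solution. *)

Require Import Defs.
From HB Require Import structures.
From mathcomp Require Import all_boot all_order all_algebra complex.
From mathcomp Require Import all_classical all_reals all_analysis.
From mathcomp Require Import ring lra zify.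

Set Implicit Arguments.
Unset Strict Implicit.
Unset Printing Implicit Defensive.

Import Order.TTheory GRing.Theory Num.Theory numFieldNormedType.Exports.

Local Open Scope classical_set_scope.
Local Open Scope ring_scope.

(** * Reciprocal polynomials *)

Section Reverse.
Variable C : numClosedFieldType.
Implicit Types (z l : C) (p q : {poly C}) (n m : nat).

(** Both [(w x3 - x1) / (w x2 - 1)] and a normalized parametrization are fractions of functions
    affine in a unimodular parameter; this is why two values of the parameter suffice wherever
    coefficients are compared, and why the values at [tau] fix the remaining scalar. A zero of [Q]
    in the closed disc forces a royal value of [x] there, so the excluded [w] come from the zeros of
    [q rev q - E rev E], a nonzero polynomial because [x] is not everywhere royal. In the converse
    direction the exceptional parameters are the obstacle to [|c| <= |d|]: equality inside the disc
    produces a zero of [zeta c + d] with [zeta] exceptional, hence happens at finitely many points,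
    so [|c| - |d|] cannot change sign there, and its value -1 at [tau] decides. Two analytic points
    come before the algebra: boundary conditions given almost everywhere are closed, so they hold on
    the whole circle by continuity; and the degree, given by a homotopy, is the winding number of
    [x3], which is read off by contracting the zeros of its Blaschke form to the origin. *)

Lemma unit_neq0 l : `|l| = 1 -> l != 0.
Proof. by move=> l1; rewrite -normr_gt0 l1 ltr01. Qed.

Lemma conj_unit l : `|l| = 1 -> l^* = l^-1.
Proof. by move=> l1; rewrite invC_norm l1 expr1n invr1 mul1r. Qed.

(** Pairwise distinct points of the unit circle, tending to 1: a source of infinitely many test
    points, and of points near a given one that avoid a finite list. *)
Definition cayley (m : nat) : C := (m%:R + 'i) / (m%:R - 'i).

Lemma nat_subi_neq0 m : m%:R - 'i != 0 :> C.
Proof.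
apply/eqP => /subr0_eq e.
have : (0 : C) <= -1 by rewrite -sqrCi -e exprn_ge0 // ler0n.
by rewrite oppr_ge0 ler10.
Qed.

Lemma norm_cayley m : `|cayley m| = 1.
Proof.
rewrite /cayley normf_div -(norm_conjC (_ + _)) rmorphD /= conjCi rmorph_nat.
by rewrite divff // normr_eq0 nat_subi_neq0.
Qed.

Lemma cayley_inj : injective cayley.
Proof.
move=> a b /eqP; rewrite eqr_div ?nat_subi_neq0 // => /eqP e.
have : ('i + 'i) * (b%:R - a%:R) = 0 :> C.
  move/eqP: e; rewrite -subr_eq0 => /eqP <-; ring.
move=> /eqP; rewrite mulf_eq0 -mulr2n mulrn_eq0 /= (negbTE (neq0Ci _)) /= subr_eq0.
by rewrite eqr_nat eq_sym => /eqP.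
Qed.

(** On the circle conjugation is inversion, so identities between reversed polynomials can be
    checked pointwise there. *)
Lemma poly_eq_circle p q : (forall l, `|l| = 1 -> p.[l] = q.[l]) -> p = q.
Proof.
move=> e; apply/eqP; rewrite -subr_eq0; apply/negPn/negP => nz.
have := max_poly_roots nz (rs := [seq cayley i | i <- iota 0 (size (p - q))]).
rewrite map_inj_uniq ?iota_uniq ?size_map ?size_iota ?ltnn; last exact: cayley_inj.
suff -> : all (root (p - q)) [seq cayley i | i <- iota 0 (size (p - q))].
  by move=> /(_ isT isT).
apply/allP => _ /mapP[i _ ->]; rewrite /root !hornerE e ?subrr //.
exact: norm_cayley.
Qed.

(* revp n p is z |-> z^n conj(p(1 / conj z)), that is z^n conj(p(z)) on the circle. *)
Definition revp n p : {poly C} := \poly_(i < n.+1) (p`_(n - i))^*.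

Lemma size_revp n p : (size (revp n p) <= n.+1)%N.
Proof. exact: size_poly. Qed.

Lemma horner_revp n p z : (size p <= n.+1)%N -> z != 0 ->
  (revp n p).[z] = z ^+ n * (p.[(z^*)^-1])^*.
Proof.
move=> sp z0; rewrite horner_poly (horner_coef_wide _ sp) rmorph_sum mulr_sumr /=.
rewrite (reindex_inj rev_ord_inj) /=; apply: eq_bigr => i _.
rewrite subSS subKn ?leq_ord // rmorphM rmorphXn fmorphV /= conjCK.
rewrite mulrCA; congr (_ * _); rewrite exprVn expfB_cond ?(negbTE z0) ?add0n ?leq_ord //.
Qed.

Lemma horner_revp_circle n p l : (size p <= n.+1)%N -> `|l| = 1 ->
  (revp n p).[l] = l ^+ n * (p.[l])^*.
Proof.
move=> sp l1; rewrite horner_revp ?unit_neq0 //.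
by rewrite (conj_unit l1) invrK.
Qed.

Lemma horner_revp0 n p : (revp n p).[0] = (p`_n)^*.
Proof. by rewrite horner_coef0 coef_poly subn0. Qed.

Lemma norm_revp n p l : (size p <= n.+1)%N -> `|l| = 1 -> `|(revp n p).[l]| = `|p.[l]|.
Proof.
by move=> sp l1; rewrite horner_revp_circle // normrM normrX l1 expr1n mul1r norm_conjC.
Qed.

Lemma revpK n p : (size p <= n.+1)%N -> revp n (revp n p) = p.
Proof.
move=> sp; apply: poly_eq_circle => l l1.
rewrite !horner_revp_circle ?size_revp // rmorphM rmorphXn /= conjCK mulrA -exprMn.
by rewrite (conj_unit l1) divff ?unit_neq0 // expr1n mul1r.
Qed.

Lemma size_mul_leS p q n m : (size p <= n.+1)%N -> (size q <= m.+1)%N ->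
  (size (p * q)%R <= (n + m).+1)%N.
Proof.
move=> sp sq; apply: leq_trans (size_polyMleq _ _) _.
by move: (leq_add sp sq); rewrite addSn addnS; case: (_ + _)%N.
Qed.

Lemma revpM n m p q : (size p <= n.+1)%N -> (size q <= m.+1)%N ->
  revp (n + m) (p * q) = revp n p * revp m q.
Proof.
move=> sp sq; apply: poly_eq_circle => l l1.
rewrite hornerM !horner_revp_circle ?size_mul_leS //.
by rewrite hornerM rmorphM exprD /= mulrACA.
Qed.

Lemma revpD n p q : revp n (p + q) = revp n p + revp n q.
Proof.
by apply/polyP => i; rewrite coefD !coef_poly coefD rmorphD; case: ifP; rewrite ?addr0.
Qed.

Lemma revpZ n a p : revp n (a *: p) = a^* *: revp n p.
Proof.
by apply/polyP => i; rewrite coefZ !coef_poly coefZ rmorphM; case: ifP; rewrite ?mulr0.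
Qed.

Lemma revpB n p q : revp n (p - q) = revp n p - revp n q.
Proof. by rewrite revpD -scaleN1r revpZ rmorphN1 scaleN1r. Qed.

Lemma size_revp_eq n p : p.[0] != 0 -> size (revp n p) = n.+1.
Proof.
move=> p0; apply/eqP; rewrite eqn_leq size_revp /=; apply: contraR p0.
rewrite -leqNgt => /leq_sizeP/(_ n (leqnn _)); rewrite coef_poly ltnSn subnn.
by rewrite horner_coef0 => /eqP; rewrite conjC_eq0.
Qed.

Definition zero_free q := forall z, `|z| <= 1 -> q.[z] != 0.

Lemma zero_free0 q : zero_free q -> q.[0] != 0.
Proof. by apply; rewrite normr0 ler01. Qed.

Lemma zero_free_neq0 q : zero_free q -> q != 0.
Proof. by move=> /zero_free0; apply: contraNneq => ->; rewrite horner0. Qed.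

Lemma coprimep_roots p q :
  (forall z, root p z -> root q z -> False) -> coprimep p q.
Proof.
move=> h; apply/negPn/negP => /closed_rootP[z].
by rewrite root_gcd => /andP[]; apply: h.
Qed.

(** Reflection in the circle moves the zeros of [p], all outside the closed disc, inside the disc,
    where [q] has none. *)
Lemma zero_free_coprime n p q : (size p <= n.+1)%N -> zero_free p -> zero_free q ->
  coprimep (revp n p) q.
Proof.
move=> sp pz qz; apply: coprimep_roots => z r1 r2.
have z1 : 1 < `|z|.
  by rewrite real_ltNge ?realE ?ler01 ?normr_ge0 //; apply/negP => /qz; rewrite (rootP r2) eqxx.
have z0 : z != 0 by rewrite -normr_gt0 (lt_trans ltr01).
move: r1; rewrite /root horner_revp // mulf_eq0 expf_eq0 (negbTE z0) andbF /= conjC_eq0.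
apply/negP/pz; rewrite normfV norm_conjC invf_le1 ?(lt_trans ltr01) //; exact: ltW.
Qed.

(** Equal moduli on the circle mean [p * revp m p = q * revp m q]. By coprimality [q] divides
    [revp m p], and the cofactor [t] satisfies [p * t = revp m q]; a degree count makes [t]
    constant. *)
Lemma blaschke_form p q m : coprimep p q -> zero_free q ->
    (forall l, `|l| = 1 -> `|p.[l]| = `|q.[l]|) ->
    maxn (size p).-1 (size q).-1 = m ->
  (size q <= m.+1)%N /\ exists2 kappa : C, `|kappa| = 1 & p = kappa *: revp m q.
Proof.
move=> cpq qz pq dm.
have q0 := zero_free_neq0 qz.
have q10 : q.[1] != 0 by apply: qz; rewrite normr1.
have p10 : p.[1] != 0 by rewrite -normr_eq0 pq ?normr1 // normr_eq0.
have p0 : p != 0 by apply: contraNneq p10 => ->; rewrite horner0.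
have sp : (size p <= m.+1)%N by rewrite -dm; case: (size p) => // a; rewrite ltnS leq_maxl.
have sq : (size q <= m.+1)%N by rewrite -dm; case: (size q) => // a; rewrite ltnS leq_maxr.
split=> //.
have e : p * revp m p = q * revp m q.
  apply: poly_eq_circle => l l1; rewrite !hornerM !horner_revp_circle //.
  by rewrite !(mulrCA _ (l ^+ m)) -!normCK pq.
have /dvdpP[t et] : q %| revp m p.
  rewrite -(Gauss_dvdpr _ (_ : coprimep q p)); last by rewrite coprimep_sym.
  by rewrite e dvdp_mulIl.
have ept : p * t = revp m q.
  by apply: (mulfI q0); rewrite -e et mulrCA [q * t]mulrC.
have sr := size_revp_eq m (zero_free0 qz).
have t0 : t != 0.
  by apply/eqP => t0; move: sr; rewrite -ept t0 mulr0 size_poly0.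
have sqt : (size q + size t <= m.+2)%N.
  have := size_revp m p; rewrite et mulrC size_mul //; by case: (_ + _)%N.
(* Either [p] has degree [m], and then so does [p * t = revp m q], or [q] has degree [m], and then
   [q * t = revp m p] has degree at most [m]; both leave only a constant [t]. *)
have st : size t = 1%N.
  have : (0 < size t)%N by rewrite lt0n size_poly_eq0.
  have : (0 < size p)%N by rewrite lt0n size_poly_eq0.
  have : (0 < size q)%N by rewrite lt0n size_poly_eq0.
  move: sr dm sqt; rewrite -ept size_mul //.
  move: (size p) (size q) (size t) => u v w; lia.
have [c c0 tc] : exists2 c, c != 0 & t = c%:P by apply/size_poly1P/eqP.
exists c^-1; last by rewrite -ept tc mulrC mul_polyC scalerA mulVf ?scale1r.
have := norm_revp sq (normr1 C); rewrite -ept tc hornerM hornerC normrM pq ?normr1 //.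
move=> /(canRL (mulKf _)); rewrite normr_eq0 normfV => -> //.
by rewrite mulVf ?invr1 // normr_eq0.
Qed.

(* As revp n Q / Q is in lowest terms and has degree n, A / B cannot have a
   common factor other than a constant. *)
Lemma match_form n (kappa : C) (Q A B : {poly C}) :
    kappa != 0 -> (size Q <= n.+1)%N -> zero_free Q ->
    (size A <= n.+1)%N -> B != 0 ->
    (forall l, `|l| = 1 -> A.[l] / B.[l] = kappa * (revp n Q).[l] / Q.[l]) ->
  exists mu : C, A = (mu * kappa) *: revp n Q /\ B = mu *: Q.
Proof.
move=> k0 sQ Qz sA B0 h.
have Q0 := zero_free_neq0 Qz.
have e : A * Q = kappa *: revp n Q * B.
  apply: (mulfI B0); apply: poly_eq_circle => l l1.
  have [Bl|Bl] := eqVneq B.[l] 0; first by rewrite !hornerM Bl !mul0r.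
  have Ql : Q.[l] != 0 by apply: Qz; rewrite l1.
  have := h l l1; rewrite !(hornerM, hornerZ) => /eqP; rewrite eqr_div // => /eqP ->.
  by ring.
have sr := size_revp_eq n (zero_free0 Qz).
have r0 : revp n Q != 0 by rewrite -size_poly_eq0 sr.
have /dvdpP[t et] : revp n Q %| A.
  rewrite -(Gauss_dvdpl _ (zero_free_coprime sQ Qz Qz)) e.
  by rewrite dvdp_mulr // dvdpZr.
have A0 : A != 0.
  apply: contraNneq B0 => A0; move/eqP: e; rewrite A0 mul0r eq_sym mulf_eq0.
  by rewrite scaler_eq0 (negbTE k0) (negbTE r0).
have t0 : t != 0 by apply: contraNneq A0 => t0; rewrite et t0 mul0r.
have st : size t = 1%N.
  have : (0 < size t)%N by rewrite lt0n size_poly_eq0.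
  move: sA; rewrite et size_mul // sr; move: (size t) => w; lia.
have [c c0 tc] : exists2 c, c != 0 & t = c%:P by apply/size_poly1P/eqP.
exists (c / kappa); split; first by rewrite et tc mul_polyC divfK.
have kr0 : kappa *: revp n Q != 0 by rewrite scaler_eq0 negb_or k0.
apply: (mulfI kr0); rewrite -e et tc -!mul_polyC.
have -> : c%:P = kappa%:P * (c / kappa)%:P by rewrite -polyCM mulrC divfK.
by ring.
Qed.

(* The zeros of q1 lie outside the closed disc and those of revp q2 inside the
   disc, so q1, being also coprime to p1, has to divide q. *)
Lemma common_denominator n (kappa : C) q p1 q1 p2 q2 : (size q <= n.+1)%N ->
    zero_free q -> coprimep p1 q1 -> zero_free q1 -> zero_free q2 ->
    (forall l, `|l| = 1 ->
       p1.[l] / q1.[l] = (p2.[l] / q2.[l])^* * (kappa * (revp n q).[l] / q.[l])) ->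
  exists2 E, p1 * q = E * q1 & forall l, `|l| = 1 -> p1.[l] / q1.[l] = E.[l] / q.[l].
Proof.
move=> sq qz cpq q1z q2z h.
pose N := maxn (size p2) (size q2).
have sp2 : (size p2 <= N.+1)%N by rewrite ltnW // ltnS leq_maxl.
have sq2 : (size q2 <= N.+1)%N by rewrite ltnW // ltnS leq_maxr.
have e : p1 * (q * revp N q2) = q1 * (kappa *: (revp N p2 * revp n q)).
  apply: poly_eq_circle => l l1.
  rewrite !(hornerM, hornerZ) (horner_revp_circle sp2 l1) (horner_revp_circle sq2 l1).
  have q10 : q1.[l] != 0 by apply: q1z; rewrite l1.
  have q0 : q.[l] != 0 by apply: qz; rewrite l1.
  have q20 : (q2.[l])^* != 0 by rewrite conjC_eq0; apply: q2z; rewrite l1.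
  have /(canRL (divfK q10)) -> := h l l1; rewrite rmorphM fmorphV /=.
  by field; rewrite q0.
have /dvdpP[t et] : q1 %| q.
  have c1 : coprimep q1 p1 by rewrite coprimep_sym.
  have c2 : coprimep q1 (revp N q2) by rewrite coprimep_sym zero_free_coprime.
  by rewrite -(Gauss_dvdpl _ c2) -(Gauss_dvdpr _ c1) e dvdp_mulIl.
exists (p1 * t) => [|l l1]; first by rewrite et; ring.
have q10 : q1.[l] != 0 by apply: q1z; rewrite l1.
have q0 : q.[l] != 0 by apply: qz; rewrite l1.
move: q0; rewrite et !hornerM mulf_eq0 negb_or => /andP[t0 _].
by field; rewrite q10.
Qed.

(** The degree bound comes for free: if [q] had degree [M > n], then [p * 'X^(M - n)] would be
    [kappa *: revp M q], but the former vanishes at 0 while the latter takes there a nonzero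
    multiple of the conjugate of the leading coefficient of [q]. *)
Lemma size_reciprocal n (kappa : C) p q : kappa != 0 ->
    (forall l, `|l| = 1 -> p.[l] = kappa * (l ^+ n * (q.[l])^*)) ->
  (size q <= n.+1)%N /\ p = kappa *: revp n q.
Proof.
move=> k0 h.
have sq : (size q <= n.+1)%N.
  rewrite leqNgt; apply/negP => sq.
  have q0 : q != 0 by rewrite -size_poly_gt0 (leq_trans _ sq).
  pose M := (size q).-1; have sM : size q = M.+1 by rewrite prednK // size_poly_gt0.
  have sqM : (size q <= M.+1)%N by rewrite sM.
  have nM : (n < M)%N by rewrite -ltnS -sM.
  have /(congr1 (fun r => r.[0])) : p * 'X^(M - n) = kappa *: revp M q.
    apply: poly_eq_circle => l l1.
    rewrite !(hornerM, hornerZ, hornerXn) h // (horner_revp_circle sqM l1).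
    by rewrite -[in RHS](subnK (ltnW nM)) exprD; ring.
  rewrite !(hornerM, hornerZ, hornerXn) horner_revp0 expr0n subn_eq0 leqNgt nM mulr0.
  move/esym/eqP; rewrite mulf_eq0 (negbTE k0) conjC_eq0 /=.
  by rewrite -[M]/((size q).-1) -lead_coefE lead_coef_eq0 (negbTE q0).
split=> //; apply: poly_eq_circle => l l1.
by rewrite h // hornerZ horner_revp_circle.
Qed.

(** On the circle this is [l * |l - z|^2]: a self-reciprocal polynomial with zeros at [z] and at its
    reflection, the latter being at infinity for [z = 0]. *)
Definition circle_factor z : {poly C} := ('X - z%:P) * (1 - z^* *: 'X).

Lemma size_circle_factor z : (size (circle_factor z) <= 3)%N.
Proof.
apply: (@size_mul_leS _ _ 1 1); first by rewrite size_XsubC.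
apply: leq_trans (size_polyD _ _) _; rewrite geq_max size_poly1 size_polyN.
by rewrite (leq_trans (size_scale_leq _ _)) ?size_polyX.
Qed.

Lemma revp_circle_factor z : revp 2 (circle_factor z) = circle_factor z.
Proof.
apply: poly_eq_circle => l l1; rewrite horner_revp_circle ?size_circle_factor //.
rewrite /circle_factor !hornerE.
have -> : ((l - z) * (1 - z^* * l))^* = (l^-1 - z^*) * (1 - z * l^-1).
  by rewrite rmorphM !rmorphB rmorphM /= conjC1 conjCK (conj_unit l1).
by field; apply: unit_neq0.
Qed.

Lemma circle_factor_neq0 z w : `|z| <= 1 -> `|w| <= 1 -> w != z -> (circle_factor z).[w] != 0.
Proof.
move=> z1 w1 wz; rewrite /circle_factor !hornerE mulf_eq0 negb_or subr_eq0 wz /=.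
apply: contra_neq wz => /subr0_eq e.
have w0 : w != 0 by apply: contra_eq_neq e => ->; rewrite mulr0 oner_neq0.
have n1 : `|z| * `|w| = 1 by rewrite -(norm_conjC z) -normrM -e normr1.
have z2 : `|z| = 1.
  apply/eqP; rewrite eq_le z1 -n1; apply: le_trans (_ : `|z| * 1 <= _).
    by rewrite ler_wpM2l.
  by rewrite mulr1.
rewrite -[RHS]invrK -(conj_unit z2) -[LHS](mulKf (_ : z^* != 0)) -?e ?mulr1 //.
by rewrite conjC_eq0 unit_neq0.
Qed.

Lemma size_mulXsubC p z : p != 0 -> size (p * ('X - z%:P)) = (size p).+1.
Proof. by move=> p0; rewrite size_mul ?polyXsubC_eq0 // size_XsubC addn2. Qed.

(** Self-reciprocity turns the zero [z] into a second one at its reflection. On the circle the two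
    coincide, and the hypothesis on the derivative makes the zero double. The cofactor is
    self-reciprocal by cancellation. *)
Lemma factor_circle_factor m (P : {poly C}) z : (size P <= m.+1.*2.+1)%N ->
    revp m.+1.*2 P = P -> `|z| <= 1 -> root P z -> (`|z| = 1 -> root P^`() z) ->
  exists P1 : {poly C}, [/\ (size P1 <= m.*2.+1)%N, revp m.*2 P1 = P1 & P = circle_factor z * P1].
Proof.
move=> sP rP z1 Pz P'z.
suff [P1 sP1 eP] : exists2 P1 : {poly C}, (size P1 <= m.*2.+1)%N & P = circle_factor z * P1.
  exists P1; split=> //.
  have c0 : circle_factor z != 0.
    rewrite mulf_neq0 ?polyXsubC_eq0 //; apply/eqP => /(congr1 (fun p => p.[0])) /eqP.
    by rewrite !hornerE subr0 oner_eq0.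
  apply: (mulfI c0); rewrite -eP -{1}rP eP -{1}revp_circle_factor -revpM ?size_circle_factor //.
have /factor_theorem[S eS] := Pz.
(* The reflection of 0 is at infinity: in place of a second root, the top coefficient of [P]
   vanishes. *)
have [z0|z0] := eqVneq z 0.
  exists S; last by rewrite eS /circle_factor z0 conjC0 scale0r polyC0 !subr0 mulr1 mulrC.
  have [->|S0] := eqVneq S 0; first by rewrite size_poly0.
  suff : (size P <= m.+1.*2)%N by rewrite eS size_mulXsubC // doubleS ltnS.
  apply/leq_sizeP => j; rewrite leq_eqVlt => /predU1P[<-|/(leq_trans sP)/leq_sizeP->//].
  have P0 : P`_0 = 0 by rewrite -horner_coef0; apply/rootP; rewrite -z0.
  by rewrite -rP coef_poly ltnSn subnn P0 conjC0.
have zc0 : z^* != 0 by rewrite conjC_eq0.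
have Sz : root S (z^*)^-1.
  have [z2|z2] := eqVneq `|z| 1.
    have := P'z z2; rewrite (conj_unit z2) invrK eS derivM derivXsubC mulr1.
    by rewrite /root hornerD hornerM hornerXsubC subrr mulr0 add0r.
  have : root P (z^*)^-1.
    by rewrite -rP /root horner_revp ?invr_eq0 // fmorphV /= conjCK invrK (rootP Pz) conjC0 mulr0.
  rewrite eS rootM orbC root_XsubC => /orP[/eqP e|//]; case/eqP: z2.
  have : `|z| ^+ 2 = 1 by rewrite normCK -{1}e mulVf.
  by move/eqP; rewrite sqrp_eq1 ?normr_ge0 // => /eqP.
have /factor_theorem[T eT] := Sz.
exists ((- z^*)^-1 *: T).
  rewrite (leq_trans (size_scale_leq _ _)) //.
  have [->|T0] := eqVneq T 0; first by rewrite size_poly0.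
  have S0 : S != 0 by rewrite eT mulf_neq0 ?polyXsubC_eq0.
  by move: sP; rewrite eS size_mulXsubC // eT size_mulXsubC // doubleS !ltnS.
rewrite eS eT /circle_factor -!mul_polyC.
have e1 : (- z^*)%:P * (- z^*)^-1%:P = 1 :> {poly C}.
  by rewrite -polyCM divff ?oppr_eq0.
have -> : 1 - (z^*)%:P * 'X = (- z^*)%:P * ('X - (z^*)^-1%:P).
  by rewrite mulrBr -polyCM mulNr divff // !polyCN mulNr opprK addrC.
by rewrite -[LHS]mul1r -e1; ring.
Qed.

(* Each z in s accounts for two zeros of P, counted at z and at its reflection
   in the circle (possibly at infinity), while P has degree 2m. *)
Lemma self_reciprocal_eq0 (s : seq C) m (P : {poly C}) : (size P <= m.*2.+1)%N -> revp m.*2 P = P ->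
    uniq s -> (m < size s)%N ->
    (forall z, z \in s -> [/\ `|z| <= 1, root P z & `|z| = 1 -> root P^`() z]) ->
  P = 0.
Proof.
elim: s m P => [//|z s IH] [|m] P sP rP /= /andP[zs us] ms h.
  have [_ + _] := h z (mem_head _ _).
  by rewrite (size1_polyC sP) rootC => /eqP->.
have [z1 Pz P'z] := h z (mem_head _ _).
have [P1 [sP1 rP1 eP]] := factor_circle_factor sP rP z1 Pz P'z.
rewrite eP (IH m P1) ?mulr0 // => w ws.
have [|w1 Pw P'w] := h w; first by rewrite inE ws orbT.
have c0 : (circle_factor z).[w] != 0.
  by apply: circle_factor_neq0 => //; apply: contraNneq zs => <-.
have P1w : root P1 w by move: Pw; rewrite eP rootM /root (negbTE c0).
split=> // /P'w; rewrite eP derivM /root hornerD !hornerM (rootP P1w) mulr0 add0r.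
by rewrite mulf_eq0 -hornerM -/(circle_factor z) (negbTE c0).
Qed.

End Reverse.

(** * The complex plane as a topological field *)

Section ComplexTopology.
Variable R : realType.
Local Notation C := R[i].
Implicit Types (z w l : C) (t : R).

Lemma real_complex_gt0 (e : R) : 0 < e -> (0 : C) < e%:C%C.
Proof. by rewrite ltcR. Qed.

Lemma near_dist_lt z (e : C) : 0 < e -> \forall w \near z, `|z - w| < e.
Proof. by move=> e0; apply/nbhs_ballP; exists e. Qed.

Lemma Re_norm_lt z (e : R) : `|z| < e%:C%C -> `|complex.Re z| < e.
Proof. by move=> ze; rewrite -ltcR; apply: le_lt_trans (normc_ge_Re z) ze. Qed.

Lemma continuous_Re : continuous (@complex.Re R : C -> R).
Proof.
move=> z; apply/(cvgrPdist_lt (FF := nbhs_filter z)) => e e0.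
apply: filterS (near_dist_lt z (real_complex_gt0 e0)) => w zw.
rewrite -(raddfB (@complex.Re R : Rcomplex R -> R)); exact: Re_norm_lt.
Qed.

Lemma continuous_Im : continuous (@complex.Im R : C -> R).
Proof.
rewrite (_ : @complex.Im R = fun z => - complex.Re (z * 'i%C)) => [z|].
  have mi : {for z, continuous (fun z : C => z * 'i%C)}.
    by apply: (cvgM (F := nbhs z)); [exact: cvg_id|exact: cvg_cst].
  by apply: (cvgN (F := nbhs z)); exact: (continuous_comp mi (@continuous_Re _)).
by apply/funext => z; rewrite ReiNIm opprK.
Qed.

Lemma continuous_conj : continuous (Num.conj : C -> C).
Proof.
move=> z; apply/(cvgrPdist_lt (FF := nbhs_filter z)) => e e0.
by apply: filterS (near_dist_lt z e0) => w zw; rewrite -rmorphB norm_conjC.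
Qed.

Lemma continuous_real_complex : continuous (fun t : R => t%:C%C).
Proof.
move=> z; apply/cvgrPdist_lt => e e0.
have eE : e = (complex.Re e)%:C%C by rewrite RRe_real // realE ltW.
near=> w.
rewrite -rmorphB eE normc_def /= expr0n addr0 sqrtr_sqr ltcR.
near: w; apply: cvgr_dist_lt; first exact: cvg_id.
by rewrite -ltcR -eE.
Unshelve. all: by end_near. Qed.

Lemma continuous_complex_horner (p : {poly C}) : continuous (fun z : C => p.[z]).
Proof.
elim/poly_ind: p => [|p c IH] z.
  rewrite (_ : (fun z => _) = cst 0); first exact: cst_continuous.
  by apply/funext => w; rewrite horner0.
rewrite (_ : (fun z => _) = (fun z => p.[z] * z + c)).
  by apply: (cvgD (F := nbhs z)); [apply: (cvgM (F := nbhs z)); [exact: IH|exact: cvg_id]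
      |exact: cvg_cst].
by apply/funext => w; rewrite hornerMXaddC.
Qed.

Lemma expiE t : expi t = (cos t)%:C%C + (sin t)%:C%C * 'i%C.
Proof. by apply/eqP; rewrite eq_complex /=; apply/andP; split; apply/eqP; ring. Qed.

Lemma continuous_expi : continuous (@expi R).
Proof.
rewrite (_ : @expi R = fun t => (cos t)%:C%C + (sin t)%:C%C * 'i%C) => [t|].
  apply: cvgD.
    by apply: continuous_comp; [exact: continuous_cos|exact: continuous_real_complex].
  apply: cvgM; last exact: cvg_cst.
  by apply: continuous_comp; [exact: continuous_sin|exact: continuous_real_complex].
by apply/funext => t; exact: expiE.
Qed.

Lemma norm_expi t : `|expi t| = 1 :> C.
Proof. by rewrite normc_def /= cos2Dsin2 sqrtr1. Qed.

Lemma expiD (t u : R) : expi (t + u) = expi t * expi u.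
Proof. by apply/eqP; rewrite eq_complex /= cosD sinD [sin t * _ + _]addrC !eqxx. Qed.

Lemma expi0 : expi 0 = 1 :> C.
Proof. by rewrite /expi cos0 sin0. Qed.

Lemma expiN t : expi (- t) = (expi t)^*.
Proof. by rewrite /expi cosN sinN. Qed.

Lemma expi_neq0 t : expi t != 0.
Proof. by rewrite -normr_gt0 norm_expi ltr01. Qed.

Lemma expi_nat t n : expi (t *+ n) = expi t ^+ n.
Proof. by elim: n => [|n IH]; rewrite ?mulr0n ?expi0 // mulrS exprS expiD IH. Qed.

Lemma expi2pi : expi (pi *+ 2) = 1 :> C.
Proof. by rewrite /expi cos2pi sin2pi. Qed.

(** An explicit continuous argument on the right half-plane. The continuous branches constructed
    below come from it, after a rotation that brings the values into this half-plane. *)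
Lemma polar_half_plane z : 0 < complex.Re z ->
  z = `|z| * expi (atan (complex.Im z / complex.Re z)).
Proof.
case: z => x y /= x0; set a := atan _.
have c0 : 0 < cos a by rewrite cos_gt0_pihalf // atan_gtNpi2 atan_ltpi2.
have e : x * sin a = y * cos a.
  have := atanK (y / x); rewrite -/a /tan => /eqP.
  by rewrite eqr_div ?lt0r_neq0 // => /eqP <-; rewrite mulrC.
have e2 : x = Num.sqrt (x ^+ 2 + y ^+ 2) * cos a.
  apply/eqP; rewrite -(@eqrXn2 _ 2) ?mulr_ge0 ?sqrtr_ge0 ?ltW // exprMn sqr_sqrtr.
    have -> : (x ^+ 2 + y ^+ 2) * cos a ^+ 2 = (x * cos a) ^+ 2 + (y * cos a) ^+ 2 by ring.
    by rewrite -e !exprMn -mulrDr cos2Dsin2 mulr1.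
  by rewrite addr_ge0 ?sqr_ge0.
apply/eqP; rewrite normc_def eq_complex /= !mul0r subr0 addr0 -e2 eqxx /=.
have := e; rewrite {1}e2 mulrAC => /(mulIf (lt0r_neq0 c0)) ->; exact: eqxx.
Qed.

Lemma circle_expi_itv l : `|l| = 1 -> exists2 t, t \in `[- pi, pi] & l = expi t.
Proof.
case: l => x y; rewrite normc_def => -[/= e].
have xy : x ^+ 2 + y ^+ 2 = 1 by rewrite -[LHS]sqr_sqrtr ?e ?expr1n // addr_ge0 ?sqr_ge0.
have x1 : -1 <= x <= 1.
  rewrite -ler_norml -(@ler_pXn2r _ 2) ?nnegrE // expr1n real_normK ?num_real //.
  by rewrite -xy lerDl sqr_ge0.
have ca : cos (acos x) = x by rewrite acosK // in_itv.
have sa : sin (acos x) = `|y| by rewrite sin_acos // -xy addrC addKr sqrtr_sqr.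
have a0 := acos_ge0 x1; have api := acos_lepi x1; have pi0 := @pi_gt0 R.
have [y0|y0] := leP 0 y.
  exists (acos x); first by rewrite in_itv /=; apply/andP; split; lra.
  by rewrite /expi ca sa ger0_norm.
exists (- acos x); first by rewrite in_itv /=; apply/andP; split; lra.
by rewrite /expi cosN sinN ca sa ltr0_norm // opprK.
Qed.

Lemma circle_expi l : `|l| = 1 -> exists t, l = expi t.
Proof. by move=> /circle_expi_itv[t _ ->]; exists t. Qed.

Lemma closed_disc_radial (U : topologicalType) (f : C -> U) l :
    {within @closed_disc R, continuous f} -> `|l| = 1 ->
  f (r%:C%C * l) @[r --> (1 : R)^'-] --> f l.
Proof.
move=> /subspace_continuousP fc l1.
have := fc l; rewrite /closed_disc /= l1 lexx => /(_ isT) fl.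
suff : (fun r : R => r%:C%C * l) @ (1 : R)^'- --> within (@closed_disc R) (nbhs l).
  by move=> h; apply: cvg_comp h fl.
move=> P lP.
have rl : (fun r : R => r%:C%C * l) @ (1 : R)^'- --> l.
  rewrite -[X in _ --> X]mul1r; apply: cvgM; last exact: cvg_cst.
  apply: cvg_at_left_filter; exact: continuous_real_complex.
have := rl _ lP; rewrite /= !near_simpl => {}rl.
near=> r; have := near rl r; rewrite /=; apply => //.
rewrite /closed_disc /= normrM l1 mulr1 normc_def /= expr0n addr0 sqrtr_sqr.
have -> : 1 = (1 : R)%:C%C :> C by [].
rewrite lecR ger0_norm.
  by near: r; exact: nbhs_left_le.
by near: r; apply: nbhs_left_ge; exact: ltr01.
Unshelve. all: by end_near. Qed.


Lemma closed_disc_eq (U : topologicalType) (f g : C -> U) : hausdorff_space U ->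
    {within @closed_disc R, continuous f} -> {within @closed_disc R, continuous g} ->
    (forall z, disc z -> f z = g z) ->
  forall z, closed_disc z -> f z = g z.
Proof.
move=> hU fc gc fg z; rewrite /closed_disc /= le_eqVlt => /predU1P[z1|]; last exact: fg.
have := closed_disc_radial fc z1; have := closed_disc_radial gc z1.
set G := (X in X --> _ -> _); set F := (X in _ -> X --> _ -> _) => gz fz.
apply: (cvg_unique hU fz); apply: cvg_trans gz; apply: near_eq_cvg.
near=> r; apply/esym/fg; rewrite /disc /= normrM z1 mulr1 normc_def /= expr0n addr0 sqrtr_sqr.
have -> : 1 = (1 : R)%:C%C :> C by [].
rewrite ltcR ger0_norm.
  by near: r; exact: nbhs_left_lt.
by near: r; apply: nbhs_left_ge; exact: ltr01.
Unshelve. all: by end_near. Qed.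

(** A nonempty open complement would contain a ball, which has positive measure. *)
Lemma ae_closed (P : R -> Prop) : closed [set t | P t] ->
  {ae lebesgue_measure, forall t : R, P t} -> forall t, P t.
Proof.
move=> cP [B [mB B0 sB]] t; apply: contrapT => nPt.
have : nbhs t (~` [set t | P t]) by apply: open_nbhs_nbhs; split => //; rewrite openC.
move=> /nbhs_ballP[e /= e0 be].
have : (lebesgue_measure (ball t e) <= lebesgue_measure B)%E.
  apply: le_measure; rewrite ?inE //; last exact: subset_trans be sB.
  by rewrite ball_itv; exact: measurable_itv.
rewrite B0 lebesgue_measure_ball; last exact: ltW.
by apply/negP; rewrite -ltNge lte_fin mulrn_wgt0.
Qed.

Lemma closed_disc_expi (U : topologicalType) (f : C -> U) :
  {within @closed_disc R, continuous f} -> continuous (fun t => f (expi t)).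
Proof.
move=> /subspace_continuousP fc t.
have ft := fc (expi t); apply: cvg_comp (ft _); last by rewrite /closed_disc /= norm_expi.
move=> P tP; have := continuous_expi tP; rewrite /= !near_simpl => h.
by near=> u; apply: (near h u) => //; rewrite /closed_disc /= norm_expi.
Unshelve. all: by end_near. Qed.

(** The radial limits are the values of the continuous extension, so a closed condition known almost
    everywhere on the circle holds at each of its points. Boundary sets are handled through
    inequalities [h <= 0] that describe them. *)
Lemma ae_circle_le (U : topologicalType) (f : C -> U) (B : set U) (h : U -> R) :
    hausdorff_space U -> {within @closed_disc R, continuous f} -> continuous h ->
    ae_circle (fun l => exists2 y, B y & f (r%:C%C * l) @[r --> (1 : R)^'-] --> y) ->
    (forall y, B y -> h y <= 0) ->
  forall l, `|l| = 1 -> h (f l) <= 0.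
Proof.
move=> hU fc hc ae Bh l /circle_expi[t ->].
apply: (ae_closed (P := fun t => h (f (expi t)) <= 0)).
  apply: (@closed_comp _ _ (fun t => h (f (expi t))) [set x | x <= 0]); last exact: closed_le.
  move=> u _; apply: continuous_comp; [exact: closed_disc_expi | exact: hc].
move: ae; apply: negligibleS => u /=; apply: contra_not => -[y By fy].
by rewrite (cvg_unique hU (closed_disc_radial fc (norm_expi u)) fy); exact: Bh.
Qed.

End ComplexTopology.

(** * The disc and the tetrablock *)

Section Disc.
Variable R : realType.
Local Notation C := R[i].
Implicit Types (z w l : C) (t : R) (p q : {poly C}).

Lemma hausdorffC : hausdorff_space C.
Proof. exact: (@norm_hausdorff C C). Qed.

Lemma norm_ReE z : `|z| = (complex.Re `|z|)%:C%C.
Proof. by rewrite RRe_real // normr_real. Qed.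

Lemma continuous_normc : continuous (fun z : C => complex.Re `|z|).
Proof.
move=> z; exact: (continuous_comp (@norm_continuous C C z) (@continuous_Re R _)).
Qed.

Lemma continuous_quotient p q z : q.[z] != 0 -> {for z, continuous (fun z => p.[z] / q.[z])}.
Proof.
move=> qz; have ch r := @continuous_complex_horner R r z.
exact: (cvgM (ch p) (cvgV qz (ch q))).
Qed.

Lemma quotient_within p q : zero_free q ->
  {within @closed_disc R, continuous (fun z => p.[z] / q.[z])}.
Proof.
move=> qz; apply: continuous_in_subspaceT => z /set_mem zD.
exact/continuous_quotient/qz.
Qed.

(** The relation [f * q = p] extends to the closed disc by continuity, so a zero of [q] on the
    circle would be a common zero of [p] and [q]. *)
Lemma coprime_continuous (f : C -> C) p q : coprimep p q ->
    (forall z, disc z -> q.[z] != 0 /\ f z = p.[z] / q.[z]) ->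
    {within @closed_disc R, continuous f} ->
  zero_free q /\ forall z, closed_disc z -> f z = p.[z] / q.[z].
Proof.
move=> cpq h fc.
have e z : closed_disc z -> f z * q.[z] = p.[z].
  apply: (closed_disc_eq hausdorffC (f := fun z => f z * q.[z]) (g := fun z => p.[z])).
  - apply/subspace_continuousP => w wD; have /subspace_continuousP/(_ w wD) := fc.
    move=> fw; have qw : q.[z] @[z --> within (@closed_disc R) (nbhs w)] --> q.[w].
      by apply: cvg_within_filter; exact: (@continuous_complex_horner R q w).
    exact: (cvgM fw qw).
  - by apply: continuous_subspaceT; exact: (@continuous_complex_horner R p).
  - by move=> w /h[qw ->]; rewrite divfK.
have qz : zero_free q.
  move=> z z1; apply/negP => qz0.
  have : root p z by rewrite /root -e // (eqP qz0) mulr0.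
  by move/(coprimep_root cpq); rewrite qz0.
by split=> // z zD; rewrite -e // mulfK // qz.
Qed.

Lemma rational_closed_disc (f : C -> C) : rational_analytic f ->
    {within @closed_disc R, continuous f} ->
  exists p q, [/\ coprimep p q, zero_free q &
    forall z, closed_disc z -> f z = p.[z] / q.[z]].
Proof.
move=> [p0 [q0 h]] fc.
have D0 : @disc R 0 by rewrite /disc /= normr0 ltr01.
have q00 : q0 != 0 by apply: contraNneq (h 0 D0).1 => ->; rewrite horner0.
pose g := gcdp p0 q0.
have g0 : g != 0 by rewrite gcdp_eq0 (negbTE q00) andbF.
have eq0 : q0 = q0 %/ g * g by rewrite divpK // dvdp_gcdr.
have ep0 : p0 = p0 %/ g * g by rewrite divpK // dvdp_gcdl.
have cpq : coprimep (p0 %/ g) (q0 %/ g) by rewrite coprimep_div_gcd // q00 orbT.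
exists (p0 %/ g), (q0 %/ g).
suff [] : zero_free (q0 %/ g) /\
    forall z, closed_disc z -> f z = (p0 %/ g).[z] / (q0 %/ g).[z] by split.
apply: coprime_continuous => // z /h[].
rewrite {1 2}eq0 {1}ep0 !hornerM mulf_eq0 negb_or => /andP[qz gz] ->; split=> //.
by rewrite -mulf_div divff // mulr1.
Qed.

Lemma injective_avoid (T : eqType) (f : nat -> T) (E : seq T) N : injective f ->
  exists2 m, (N <= m)%N & f m \notin E.
Proof.
move=> fi; apply: contrapT => h.
have : (size [seq f i | i <- iota N (size E).+1] <= size E)%N.
  apply: uniq_leq_size => [|_ /mapP[i iN ->]]; first by rewrite map_inj_uniq // iota_uniq.
  apply/negPn/negP => fE; apply: h; exists i => //.
  by move: iN; rewrite mem_iota => /andP[].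
by rewrite size_map size_iota ltnn.
Qed.

Lemma cayley_near1 m : (0 < m)%N -> `|cayley C m - 1| <= 2 / m%:R.
Proof.
move=> m0; have -> : cayley C m - 1 = 2 * 'i / (m%:R - 'i).
  by rewrite /cayley; field; exact: nat_subi_neq0.
rewrite normf_div normrM normCi mulr1 normr_nat.
rewrite ler_pM2l ?ltr0n // lef_pV2 ?posrE ?ltr0n ?normr_gt0 ?nat_subi_neq0 //.
apply: le_trans (normc_ge_Re _).
have -> : m%:R = (m%:R : R)%:C%C :> C by rewrite rmorph_nat.
by rewrite -complexiE /= subr0 normr_nat.
Qed.

Lemma circle_avoid (E : seq C) l (e : R) : `|l| = 1 -> 0 < e ->
  exists z, [/\ `|z| = 1, z \notin E & `|l - z| < e%:C%C].
Proof.
move=> l1 e0; have li : injective (fun m => l * cayley C m).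
  by apply: inj_comp (@cayley_inj C); exact/mulfI/unit_neq0.
have [N Ne] : exists N : nat, 2 / e < N%:R.
  by exists (Num.truncn (2 / e)).+1; apply: truncnS_gt.
have [m mN mE] := injective_avoid E N.+1 li.
exists (l * cayley C m); split=> //; first by rewrite normrM l1 norm_cayley mulr1.
rewrite -[X in `|X - _|]mulr1 -mulrBr normrM l1 mul1r distrC.
apply: le_lt_trans (cayley_near1 _) _; first exact: leq_trans mN.
have -> : 2 / m%:R = (2 / m%:R : R)%:C%C :> C by rewrite rmorphM fmorphV !rmorph_nat.
rewrite ltcR ltr_pdivrMr ?ltr0n ?(leq_trans _ mN) // mulrC -ltr_pdivrMr //.
by apply: lt_le_trans Ne _; rewrite ler_nat ltnW.
Qed.

Lemma circle_cofinite_le (E : seq C) (h : C -> R) : continuous h ->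
    (forall z, `|z| = 1 -> z \notin E -> h z <= 0) ->
  forall l, `|l| = 1 -> h l <= 0.
Proof.
move=> hc hE l l1; rewrite leNgt; apply/negP => hl.
have /nbhs_ballP[e /= e0 be] : \forall z \near l, 0 < h z.
  exact: (cvgr_gt (F := nbhs l) _ (hc l)).
have [|z [z1 zE lz]] := @circle_avoid E l (complex.Re e) l1.
  by rewrite -ltcR RRe_real // realE ltW.
have : 0 < h z.
  apply: be; rewrite -ball_normE /= (_ : e = (complex.Re e)%:C%C) //.
  by rewrite RRe_real // realE ltW.
by apply/negP; rewrite -leNgt hE.
Qed.

Lemma closed_disc_le (h : C -> R) : continuous h -> (forall z, disc z -> h z <= 0) ->
  forall z, closed_disc z -> h z <= 0.
Proof.
move=> hc hD z; rewrite /closed_disc /= le_eqVlt => /predU1P[z1|]; last exact: hD.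
have hz := closed_disc_radial (continuous_subspaceT hc) z1.
apply: (cvgr_to_le hz).
near=> r; apply: hD; rewrite /disc /= normrM z1 mulr1 normc_def /= expr0n addr0 sqrtr_sqr.
have -> : 1 = (1 : R)%:C%C :> C by [].
rewrite ltcR ger0_norm.
  by near: r; exact: nbhs_left_lt.
by near: r; apply: nbhs_left_ge; exact: ltr01.
Unshelve. all: by end_near. Qed.

Lemma le_norm_ReE z w : (`|z| <= `|w|) = (complex.Re `|z| - complex.Re `|w| <= 0).
Proof. by rewrite subr_le0 -lecR -!norm_ReE. Qed.

Lemma continuous_normB p q : continuous (fun z : C => complex.Re `|p.[z]| - complex.Re `|q.[z]|).
Proof.
move=> z; have h r := continuous_comp (@continuous_complex_horner R r z) (@continuous_normc _).
exact: (cvgB (h p) (h q)).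
Qed.

(** With [v = x3 * z], a zero of the defining polynomial says that [1 - conj(x2) v = w (x2 - v)];
    the Moebius inequality [|x2 - v| <= |1 - conj(x2) v|] excludes this for [|w| < 1]. *)
Lemma boundary_closed_tetrablock (x : C * C * C) :
  tetrablock_boundary x -> closed_tetrablock x.
Proof.
case: x => [[x1 x2] x3] [/= -> x31 x21] z w z1 w1; apply/eqP => /= e.
have /(congr1 (fun u => `|u|)) : 1 - x2^* * (x3 * z) = w * (x2 - x3 * z).
  by apply/eqP; rewrite -subr_eq0 -e; apply/eqP; ring.
rewrite normrM; set v := x3 * z => e1.
have v1 : `|v| < 1 by rewrite normrM x31 mul1r.
have e2 : `|1 - x2^* * v| ^+ 2 - `|x2 - v| ^+ 2 = (1 - `|x2| ^+ 2) * (1 - `|v| ^+ 2).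
  by rewrite !normCK !rmorphB /= rmorphM /= conjC1 conjCK; ring.
have d0 : 0 < `|1 - x2^* * v|.
  rewrite normr_gt0 subr_eq0; apply/eqP => xv.
  have : 1 <= `|v| by rewrite -(normr1 C) xv normrM norm_conjC ler_piMl.
  by move/(lt_le_trans v1); rewrite ltxx.
have le : `|x2 - v| <= `|1 - x2^* * v|.
  rewrite -(@ler_pXn2r _ 2) ?nnegrE // -subr_ge0 e2 mulr_ge0 // subr_ge0.
    by rewrite expr_le1.
  by rewrite expr_le1 // ltW.
have : `|1 - x2^* * v| < `|1 - x2^* * v|.
  rewrite {1}e1; apply: le_lt_trans (_ : `|w| * `|1 - x2^* * v| < _); first exact: ler_wpM2l.
  by rewrite gtr_pMl.
by rewrite ltxx.
Qed.

(** Solving the defining equation for [z] gives [(1 - x2 w) / (x1 - x3 w)], which must stay out of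
    the disc; points [w] of the circle follow by continuity. *)
Lemma tetrablock_bounds (x : C * C * C) : closed_tetrablock x ->
  `|x.1.2| <= 1 /\ forall w, `|w| <= 1 -> `|x.1.1 - x.2 * w| <= `|1 - x.1.2 * w|.
Proof.
case: x => [[x1 x2] x3] /= h; split.
  rewrite real_leNgt ?realE ?ler01 ?normr_ge0 //; apply/negP => x21.
  have x20 : x2 != 0 by rewrite -normr_gt0 (lt_trans ltr01).
  have := h 0 x2^-1; rewrite normr0 ltr01 normfV invf_lt1 ?(lt_trans ltr01) // => /(_ isT x21).
  by rewrite /= !(mulr0, mul0r) subr0 addr0 divff // subrr eqxx.
move=> w w1; rewrite le_norm_ReE.
have -> : x1 - x3 * w = (x1%:P - x3 *: 'X).[w] by rewrite !hornerE.
have -> : 1 - x2 * w = (1 - x2 *: 'X).[w] by rewrite !hornerE.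
move: w w1; apply: closed_disc_le; first exact: continuous_normB.
move=> w w1; rewrite -le_norm_ReE !hornerE real_leNgt ?realE ?normr_ge0 //; apply/negP => lt.
have n0 : x1 - x3 * w != 0 by rewrite -normr_gt0 (le_lt_trans _ lt).
have := h ((1 - x2 * w) / (x1 - x3 * w)) w; rewrite normrM normfV ltr_pdivrMr ?normr_gt0 //.
rewrite mul1r => /(_ lt w1) /=; rewrite (_ : _ + _ = 0) ?eqxx //.
by field.
Qed.

(* For fixed z in the disc, the zero of the defining polynomial in w never meets
   the unit circle while z is scaled down to 0, where it lies outside. *)
Lemma closed_tetrablockP (x : C * C * C) : `|x.1.2| <= 1 ->
    (forall w, `|w| = 1 -> `|x.1.1 - x.2 * w| <= `|1 - x.1.2 * w|) ->
  closed_tetrablock x.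
Proof.
case: x => [[x1 x2] x3] /= x21 h z w z1 w1 /=.
(* If [|x2| = 1], the zero in [w] lies on the circle already for [z = 0]. In this case the
   hypothesis at the conjugate of [x2] forces [x3 = x1 * x2], and the polynomial factors. *)
have [x2e|x2e] := eqVneq `|x2| 1.
  have cx : x2 * x2^* = 1 by rewrite -normCK x2e expr1n.
  have := h x2^*; rewrite norm_conjC => /(_ x2e).
  rewrite cx subrr normr0 normr_le0 subr_eq0 => /eqP ex1.
  have x3E : x3 = x1 * x2 by rewrite ex1 -mulrA (mulrC _ x2) cx mulr1.
  have x11 : `|x1| <= 1.
    have := h (- x2^*); rewrite normrN norm_conjC => /(_ x2e).
    have -> : x1 - x3 * - x2^* = x1 *+ 2 by rewrite x3E mulrN opprK -mulrA cx mulr1.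
    have -> : 1 - x2 * - x2^* = 1 *+ 2 by rewrite mulrN opprK cx.
    by rewrite !normrMn normr1 ler_pMn2r.
  rewrite (_ : _ + _ = (1 - x1 * z) * (1 - x2 * w)); last by rewrite x3E; ring.
  have nz (u v : C) : `|u| <= 1 -> `|v| < 1 -> 1 - u * v != 0.
    move=> u1 v1; rewrite subr_eq0; apply/eqP => uv.
    have : `|1 : C| <= `|v| by rewrite uv normrM ler_piMl.
    by rewrite normr1 => /(lt_le_trans v1); rewrite ltxx.
  by rewrite mulf_neq0 // nz.
have {}x21 : `|x2| < 1 by rewrite lt_neqAle x2e.
(* [g t > 0] says that the zero in [w] belonging to [s = t z], namely [(1 - x1 s) / (x2 - x3 s)],
   lies outside the closed disc. *)
pose g t : R := complex.Re `|1 - x1 * (t%:C%C * z)| - complex.Re `|x2 - x3 * (t%:C%C * z)|.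
have gc : continuous g.
  have aff (u v : C) : continuous (fun t : R => complex.Re `|u - v * (t%:C%C * z)|).
    move=> t.
    have ct : (fun t : R => u - v * (t%:C%C * z)) @ t --> u - v * (t%:C%C * z).
      apply: cvgB; first exact: cvg_cst.
      apply: cvgM; first exact: cvg_cst.
      apply: cvgM; last exact: cvg_cst.
      exact: (@continuous_real_complex R t).
    exact: (continuous_comp ct (@continuous_normc _)).
  move=> t; exact: (cvgB (aff _ _ t) (aff _ _ t)).
have g0 t : 0 <= t <= 1 -> g t != 0.
  move=> /andP[t0 t1]; set s := t%:C%C * z.
  have s1 : `|s| < 1.
    rewrite normrM; apply: le_lt_trans z1; rewrite ler_piMl // normc_def /= expr0n addr0.
    by rewrite sqrtr_sqr ger0_norm // lecR.
  rewrite subr_eq0; apply/eqP => /(congr1 (fun x => x%:C%C)); rewrite -!norm_ReE -/s => e.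
  have [u u1 eu] : exists2 u : C, `|u| = 1 & 1 - x1 * s = u * (x2 - x3 * s).
    have [d0|d0] := eqVneq (x2 - x3 * s) 0.
      exists 1; first exact: normr1.
      by apply/eqP; rewrite d0 mulr0 -normr_eq0 e d0 normr0.
    exists ((1 - x1 * s) / (x2 - x3 * s)); last by rewrite divfK.
    by rewrite normrM normfV e divff // normr_eq0.
  have e1 : 1 - x2 * u = s * (x1 - x3 * u).
    by rewrite -[1](subrK (x1 * s)) eu; ring.
  have d0 : 0 < `|1 - x2 * u|.
    rewrite normr_gt0 subr_eq0; apply/eqP => xu.
    have : `|x2 * u| < 1 by rewrite normrM u1 mulr1.
    by rewrite -xu normr1 ltxx.
  have : `|1 - x2 * u| < `|1 - x2 * u|.
    rewrite {1}e1 normrM; apply: le_lt_trans (_ : `|s| * `|1 - x2 * u| < _).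
      by rewrite ler_wpM2l // h.
    by rewrite gtr_pMl.
  by rewrite ltxx.
have g00 : 0 < g 0 by rewrite /g !mul0r !mulr0 !subr0 normr1 subr_gt0 -ltcR -norm_ReE.
have g1 : 0 < g 1.
  rewrite ltNge; apply/negP => g1.
  have [||t tI gt] := @IVT R g 0 1 0 ler01.
  - exact: continuous_subspaceT.
  - by rewrite ge_min le_max g1 (ltW g00) orbT.
  by have := g0 t; rewrite gt eqxx => /(_ tI).
apply/eqP => e.
have e1 : 1 - x1 * z = w * (x2 - x3 * z) by apply/eqP; rewrite -subr_eq0 -e; apply/eqP; ring.
move: g1; rewrite /g subr_gt0 mul1r -ltcR -!norm_ReE e1 normrM => lt.
have : `|x2 - x3 * z| < `|x2 - x3 * z|.
  by apply: lt_le_trans lt _; rewrite ler_piMl // ltW.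
by rewrite ltxx.
Qed.

End Disc.

(** * Phasar derivatives *)

Section Phasar.
Variable R : realType.
Local Notation C := R[i].
Implicit Types (z w l : C) (t : R) (p q : {poly C}) (F G : R -> C).

Definition is_cderive F t (D : C) :=
  is_derive t 1 (fun s => complex.Re (F s)) (complex.Re D) /\
  is_derive t 1 (fun s => complex.Im (F s)) (complex.Im D).

Lemma is_cderive_cst z t : is_cderive (fun _ => z) t 0.
Proof. by split; exact: is_derive_cst. Qed.

Lemma ReD z w : complex.Re (z + w) = complex.Re z + complex.Re w.
Proof. by case: z w => [x y] [u v]. Qed.

Lemma ImD z w : complex.Im (z + w) = complex.Im z + complex.Im w.
Proof. by case: z w => [x y] [u v]. Qed.

Lemma ReM z w : complex.Re (z * w) =
  complex.Re z * complex.Re w - complex.Im z * complex.Im w.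
Proof. by case: z w => [x y] [u v]. Qed.

Lemma ImM z w : complex.Im (z * w) =
  complex.Re z * complex.Im w + complex.Im z * complex.Re w.
Proof. by case: z w => [x y] [u v]. Qed.

Lemma ReJ z : complex.Re z^* = complex.Re z.
Proof. by case: z. Qed.

Lemma ImJ z : complex.Im z^* = - complex.Im z.
Proof. by case: z. Qed.

Lemma is_cderiveD F G t D E : is_cderive F t D -> is_cderive G t E ->
  is_cderive (fun s => F s + G s) t (D + E).
Proof.
move=> [FR FI] [GR GI]; split; rewrite (ReD, ImD).
  rewrite (_ : (fun s => _) = (fun s => complex.Re (F s)) + (fun s => complex.Re (G s))).
    exact: is_deriveD.
  by apply/funext => s; exact: ReD.
rewrite (_ : (fun s => _) = (fun s => complex.Im (F s)) + (fun s => complex.Im (G s))).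
  exact: is_deriveD.
by apply/funext => s; exact: ImD.
Qed.

Lemma is_cderiveM F G t D E : is_cderive F t D -> is_cderive G t E ->
  is_cderive (fun s => F s * G s) t (D * G t + F t * E).
Proof.
move=> [FR FI] [GR GI]; split.
  rewrite (_ : (fun s => _) = (fun s => complex.Re (F s)) * (fun s => complex.Re (G s)) -
     (fun s => complex.Im (F s)) * (fun s => complex.Im (G s))).
    apply: (is_derive_eq (is_deriveB (is_deriveM FR GR) (is_deriveM FI GI))).
    rewrite ReD !ReM /GRing.scale /=.
    move: (complex.Re _) (complex.Im _) (complex.Re _) (complex.Im _) => *; ring.
  by apply/funext => s; exact: ReM.
rewrite (_ : (fun s => _) = (fun s => complex.Re (F s)) * (fun s => complex.Im (G s)) +
   (fun s => complex.Im (F s)) * (fun s => complex.Re (G s))).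
  apply: (is_derive_eq (is_deriveD (is_deriveM FR GI) (is_deriveM FI GR))).
  rewrite ImD !ImM /GRing.scale /=.
  move: (complex.Re _) (complex.Im _) (complex.Re _) (complex.Im _) => *; ring.
by apply/funext => s; exact: ImM.
Qed.

Lemma is_cderiveJ F t D : is_cderive F t D -> is_cderive (fun s => (F s)^*) t D^*.
Proof.
move=> [FR FI]; split.
  rewrite ReJ (_ : (fun s => _) = (fun s => complex.Re (F s))) //.
  by apply/funext => s; rewrite ReJ.
rewrite ImJ (_ : (fun s => _) = - (fun s => complex.Im (F s))); first exact: is_deriveN.
by apply/funext => s; rewrite ImJ.
Qed.

Lemma is_cderive_expi t : is_cderive (@expi R) t ('i * expi t).
Proof.
rewrite -complexiE; split; rewrite ?ReM ?ImM /=.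
  by apply: is_derive_eq; ring.
by apply: is_derive_eq; ring.
Qed.

Lemma is_cderive_eq F t D E : is_cderive F t D -> D = E -> is_cderive F t E.
Proof. by move=> ? <-. Qed.

Lemma is_cderive_unique F t D E : is_cderive F t D -> is_cderive F t E -> D = E.
Proof.
move=> [[_ FR] [_ FI]] [[_ GR] [_ GI]]; apply/eqP; rewrite eq_complex.
by rewrite -FR -FI -GR -GI !eqxx.
Qed.

Lemma is_cderive_horner p t :
  is_cderive (fun s => p.[expi s]) t ('i * expi t * p^`().[expi t]).
Proof.
elim/poly_ind: p => [|p c IH].
  rewrite (_ : (fun s => _) = fun _ => 0); last by apply/funext => s; rewrite horner0.
  by rewrite deriv0 horner0 mulr0; exact: is_cderive_cst.
rewrite (_ : (fun s => _) = fun s => p.[expi s] * expi s + c); last first.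
  by apply/funext => s; rewrite hornerMXaddC.
apply: is_cderive_eq (is_cderiveD (is_cderiveM IH (is_cderive_expi t)) (is_cderive_cst c t)) _.
by rewrite derivMXaddC hornerD hornerM hornerX; ring.
Qed.

Lemma Re_real_complex (x : R) z : complex.Re (x%:C%C * z) = x * complex.Re z.
Proof. by rewrite ReM /= mul0r subr0. Qed.

Lemma Im_real_complex (x : R) z : complex.Im (x%:C%C * z) = x * complex.Im z.
Proof. by rewrite ImM /= mul0r addr0. Qed.

Lemma norm_polar (c : C) t : 0 <= c -> c * expi t = `|c * expi t| * expi t.
Proof. by move=> c0; rewrite normrM norm_expi mulr1 ger0_norm. Qed.

Lemma is_cderive_prodJ p q t :
  is_cderive (fun s => p.[expi s] * (q.[expi s])^*) t
    ('i * expi t * p^`().[expi t] * (q.[expi t])^* +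
     p.[expi t] * ('i * expi t * q^`().[expi t])^*).
Proof. by apply: is_cderiveM; last apply: is_cderiveJ; exact: is_cderive_horner. Qed.

Lemma norm2J z : z * z^* = (complex.Re `|z| ^+ 2)%:C%C.
Proof.
rewrite -normCK; have := norm_ReE z; move: (complex.Re _) => x ->.
exact: (esym (rmorphXn (real_complex R) 2 x)).
Qed.

Lemma Re_norm_ge0 z : 0 <= complex.Re `|z|.
Proof. by rewrite -lecR -norm_ReE; exact: normr_ge0. Qed.

(** * Points of the circle where two polynomials have the same modulus *)

Section Contact.
Variables (p q : {poly C}) (l : C).
Hypothesis pq : forall z, `|z| = 1 -> `|p.[z]| <= `|q.[z]|.
Hypothesis l1 : `|l| = 1.
Hypothesis el : `|p.[l]| = `|q.[l]|.

Let y := l * (q^`().[l] * (q.[l])^* - p^`().[l] * (p.[l])^*).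
(** [F] is [|q|^2 - |p|^2] along the circle. Its derivative [D] is twice the real part of ['i * x],
    so it vanishes exactly when [x] is real. *)
Let F t := q.[expi t] * (q.[expi t])^* + (-1) * (p.[expi t] * (p.[expi t])^*).
Let D t := let x := expi t * (q^`().[expi t] * (q.[expi t])^* - p^`().[expi t] * (p.[expi t])^*) in
  'i * x + ('i * x)^*.

Let FD t : is_cderive F t (D t).
Proof.
have h := is_cderiveD (is_cderive_prodJ q q t)
  (is_cderiveM (is_cderive_cst (-1) t) (is_cderive_prodJ p p t)).
apply: is_cderive_eq h _; rewrite /D !(rmorphM, rmorphB) /= !conjCK; ring.
Qed.

(* The nonnegative function |q|^2 - |p|^2 on the circle has a minimum at l. *)
Lemma contact_real : y \is Num.real.
Proof.
have [t0 lE] := circle_expi l1.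
have ReF t : complex.Re (F t) = complex.Re `|q.[expi t]| ^+ 2 - complex.Re `|p.[expi t]| ^+ 2.
  by rewrite /F !norm2J mulN1r; exact: ReD.
have F0 : is_derive t0 1 (fun s => complex.Re (F s)) 0.
  apply: (@derive1_at_min _ _ (t0 - 1) (t0 + 1)).
  - by rewrite lerD2l; lra.
  - by move=> t _; have [[? _] _] := FD t.
  - by rewrite in_itv /= ltrBlDr !ltrDl ltr01.
  - move=> t _; rewrite !ReF -lE el subrr subr_ge0.
    rewrite ler_pXn2r ?nnegrE ?Re_norm_ge0 // -lecR -!norm_ReE.
    by apply: pq; exact: norm_expi.
have [[_ d1] _] := FD t0; have [_ d2] := F0.
move: d1; rewrite d2 /D /= -lE -/y => /eqP.
rewrite ReD ReJ -mulr2n eq_sym mulrn_eq0 /= -complexiE mulrC ReiNIm oppr_eq0.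
by case: y => a b /=; rewrite complex_real.
Qed.

(** On the circle this polynomial is [l^n * (|q|^2 - |p|^2)], and the second factor vanishes at [l]
    together with its angular derivative. *)
Lemma contact_double_root n : (size p <= n.+1)%N -> (size q <= n.+1)%N ->
  root (q * revp n q - p * revp n p)^`() l.
Proof.
move=> sp sq; have [t0 lE] := circle_expi l1.
set P := _ - _.
have PF t : P.[expi t] = ('X^n).[expi t] * F t.
  rewrite /P !hornerE !horner_revp_circle ?norm_expi // /F; ring.
have F0 : F t0 = 0.
  by rewrite /F -lE !norm2J el mulN1r subrr.
have D0 : D t0 = 0.
  rewrite /D -lE -/y rmorphM /= conjCi conj_Creal ?contact_real //; ring.
have := is_cderiveM (is_cderive_horner 'X^n t0) (FD t0).
rewrite F0 D0 !mulr0 addr0 => h1.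
have h2 : is_cderive (fun s => ('X^n).[expi s] * F s) t0 ('i * expi t0 * P^`().[expi t0]).
  rewrite (_ : (fun s => _) = fun s => P.[expi s]); first exact: is_cderive_horner.
  by apply/funext => s; rewrite PF.
have /eqP := is_cderive_unique h2 h1.
by rewrite !mulf_eq0 (negbTE (neq0Ci _)) (negbTE (expi_neq0 _)) /= -lE.
Qed.

End Contact.

(* The logarithmic derivative, with respect to the angle, of p/q is 'i times this number. *)
Definition log_derivative p q l := l * (p^`().[l] / p.[l] - q^`().[l] / q.[l]).

(** A phasar derivative only gives the real part of [log_derivative p q l]; reality recovers the
    complex number itself, with which one can compute algebraically. *)
Lemma log_derivative_real p q l : (forall z, `|z| = 1 -> `|p.[z]| <= `|q.[z]|) ->
    `|l| = 1 -> `|p.[l]| = `|q.[l]| -> q.[l] != 0 -> log_derivative p q l \is Num.real.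
Proof.
move=> pq l1 el q0; have p0 : p.[l] != 0 by rewrite -normr_eq0 el normr_eq0.
have := contact_real pq l1 el.
have ep : (p.[l])^* = `|q.[l]| ^+ 2 / p.[l].
  by rewrite -el normCK mulrAC divff // mul1r.
have eq : (q.[l])^* = `|q.[l]| ^+ 2 / q.[l].
  by rewrite normCK mulrAC divff // mul1r.
rewrite ep eq => h.
have -> : log_derivative p q l = - (l * (q^`().[l] * (`|q.[l]| ^+ 2 / q.[l]) -
    p^`().[l] * (`|q.[l]| ^+ 2 / p.[l]))) / `|q.[l]| ^+ 2.
  have n0 : `|q.[l]| != 0 by rewrite normr_eq0.
  by rewrite /log_derivative; field; rewrite q0 p0 n0.
by rewrite rpredM ?rpredN ?rpredV ?rpredX ?normr_real.
Qed.

(** Where [q] does not vanish, [p / q] has the argument of [p] times the conjugate of [q]. The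
    constant [W] rotates this product to [F], which takes the positive value [m] at [l], so that the
    derivative of its argument there is that of [Im F] divided by [m]. *)
Lemma phasar_derivativeP p q (f : C -> C) l (r : R) :
    (forall z, `|z| = 1 -> f z = p.[z] / q.[z]) ->
    `|l| = 1 -> p.[l] != 0 -> q.[l] != 0 ->
  is_phasar_derivative f l r <-> complex.Re (log_derivative p q l) = r.
Proof.
move=> fE l1 p0 q0.
pose W := (p.[l] * (q.[l])^*)^*.
pose m := complex.Re `|p.[l] * (q.[l])^*| ^+ 2.
pose F t := p.[expi t] * (q.[expi t])^* * W.
have W0 : W != 0 by rewrite conjC_eq0 mulf_neq0 // conjC_eq0.
have m0 : 0 < m by rewrite exprn_gt0 // -ltcR -norm_ReE normr_gt0 -conjC_eq0.
have Fl t : expi t = l -> F t = m%:C%C by move=> tl; rewrite /F tl norm2J.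
have Fd t : expi t = l -> exists2 D, is_cderive F t D &
    complex.Im D = m * complex.Re (log_derivative p q l).
  move=> tl; have h := is_cderiveM (is_cderive_prodJ p q t) (is_cderive_cst W t).
  exists (m%:C%C * ('i * (l * (p^`().[l] / p.[l])) + ('i * (l * (q^`().[l] / q.[l])))^*)).
    apply: is_cderive_eq h _; rewrite tl -(Fl t tl) /F tl !rmorphM /= fmorphV /=.
    have qc0 : (q.[l])^* != 0 by rewrite conjC_eq0.
    by field; rewrite p0 qc0.
  rewrite Im_real_complex; congr (_ * _).
  rewrite /log_derivative mulrBr; move: (l * _) (l * _) => a b.
  rewrite -complexiE ImD ImJ (mulrC _ a) (mulrC _ b) !ImiRe.
  by case: a b => [? ?] [? ?].
split.
  move=> [t0 [u [tl near_f du]]].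
  have [D FD ImD0] := Fd t0 tl.
  pose v s := u s - u t0.
  have dv : is_derive t0 1 v r.
    rewrite -[r]subr0; apply: is_deriveB; exact: is_derive_cst.
  (* [F s] is a real multiple of [expi (v s)]. Eliminating the multiple leaves a relation that can
     be differentiated at [t0], where [Im F] and [v] vanish. *)
  have eqF : \forall s \near t0, complex.Im (F s) * cos (v s) = complex.Re (F s) * sin (v s).
    have key s : f (expi s) != 0 /\ f (expi s) = `|f (expi s)| * expi (u s) ->
        exists2 c : C, c \is Num.real & p.[expi s] * (q.[expi s])^* = c * expi (u s).
      rewrite fE ?norm_expi // => -[n0 e].
      exists (`|p.[expi s] / q.[expi s]| * `|q.[expi s]| ^+ 2).
        by rewrite rpredM ?rpredX ?normr_real.
      have qs0 : q.[expi s] != 0 by apply: contraNneq n0 => ->; rewrite invr0 mulr0.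
      rewrite normCK.
      have -> : p.[expi s] * (q.[expi s])^* =
          p.[expi s] / q.[expi s] * (q.[expi s] * (q.[expi s])^*).
        by rewrite mulrA divfK.
      by rewrite {1}e mulrAC.
    have [c0 c0r e0] := key t0 (nbhs_singleton near_f).
    apply: filterS near_f => s /key[c cr e].
    have -> : F s = c * c0 * expi (v s).
      rewrite /F /W -tl e e0 rmorphM /= (conj_Creal c0r) expiD expiN; ring.
    have /complex_realP[x ->] : c * c0 \is Num.real by rewrite rpredM.
    rewrite Im_real_complex Re_real_complex /=; ring.
  have v0 : v t0 = 0 by rewrite /v subrr.
  have F0 := Fl t0 tl.
  have [FR FI] := FD.
  have d1 := is_deriveM FI (is_derive1_comp (is_derive_cos (v t0)) dv).
  have d2 := is_deriveM FR (is_derive1_comp (is_derive_sin (v t0)) dv).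
  have [_ e1] := near_eq_is_derive eqF d1; have [_ e2] := d2.
  have := etrans (esym e1) e2.
  rewrite /= v0 F0 cos0 sin0 ImD0 /GRing.scale /= !mul0r add0r addr0 !mul1r.
  by move=> /(mulfI (lt0r_neq0 m0)).
move=> <-.
have [t0 lE] := circle_expi l1; have [D FD ImD0] := Fd t0 (esym lE).
have F0 := Fl t0 (esym lE).
have [u0 uE] : exists u0, p.[l] * (q.[l])^* = `|p.[l] * (q.[l])^*| * expi u0.
  have n0 : `|p.[l] * (q.[l])^*| != 0 by rewrite normr_eq0 -conjC_eq0.
  have [|u0 uE] := @circle_expi R (p.[l] * (q.[l])^* / `|p.[l] * (q.[l])^*|).
    by rewrite normrM normfV normr_id divff.
  by exists u0; rewrite -uE mulrCA divff // mulr1.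
(* The constant [u0] undoes the rotation by [W]. *)
exists t0, (fun s => u0 + atan (complex.Im (F s) / complex.Re (F s))).
have [FR FI] := FD.
have ReF0 : complex.Re (F t0) = m by rewrite F0.
have ImF0 : complex.Im (F t0) = 0 by rewrite F0.
split=> //.
  have near_F : \forall s \near t0, 0 < complex.Re (F s).
    have /derivable1_diffP/differentiable_continuous cF :
        derivable (fun s => complex.Re (F s)) t0 1.
      by have [] := FR.
    by apply: (cvgr_gt _ cF); rewrite ReF0.
  apply: filterS near_F => s Fs.
  have Fs0 : F s != 0 by apply: contraTneq Fs => ->; rewrite ltxx.
  have [ps0 qs0] : p.[expi s] != 0 /\ q.[expi s] != 0.
    by move: Fs0; rewrite /F !mulf_eq0 !negb_or conjC_eq0 => /andP[/andP[]].
  rewrite fE ?norm_expi //; split; first by rewrite mulf_neq0 ?invr_eq0.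
  set a := u0 + _.
  suff -> : p.[expi s] / q.[expi s] = `|F s| / `|W| / `|q.[expi s]| ^+ 2 * expi a.
    by apply: norm_polar; rewrite !divr_ge0 ?exprn_ge0.
  have eF := polar_half_plane Fs.
  have eW : W = `|W| * (expi u0)^*.
    by rewrite /W norm_conjC {1}uE rmorphM /= conj_normC.
  have ePQ : p.[expi s] * (q.[expi s])^* = F s / W by rewrite /F mulfK.
  have -> : p.[expi s] / q.[expi s] = p.[expi s] * (q.[expi s])^* / `|q.[expi s]| ^+ 2.
    have qc0 : (q.[expi s])^* != 0 by rewrite conjC_eq0.
    by rewrite normCK; field; rewrite qs0 qc0.
  rewrite ePQ {1}eF {1}eW invfM -(conj_unit (_ : `|(expi u0)^*| = 1)) ?norm_conjC ?norm_expi //.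
  by rewrite conjCK /a expiD; ring.
rewrite -[complex.Re _]add0r; apply: is_deriveD.
have dq := is_deriveM FI (is_deriveV (_ : complex.Re (F t0) != 0) FR).
have d := is_derive1_comp (is_derive1_atan _) (dq _).
apply: (is_derive_eq (d _)); first by rewrite ReF0 lt0r_neq0.
rewrite ReF0 ImF0; set g := (X in (1 + X ^+ 2)^-1).
have -> : g = 0 by rewrite /g -[LHS]/(complex.Im (F t0) * _) ImF0 mul0r.
rewrite expr0n addr0 invr1 mul1r ImD0 /GRing.scale /= mul0r add0r.
by rewrite mulKf // lt0r_neq0.
Qed.

End Phasar.

(** * Winding numbers *)

Section Winding.
Variable R : realType.
Local Notation C := R[i].
Implicit Types (z w l : C) (t : R) (F G : R -> C).

(* The closed curve F, parametrized by [0, 2 pi], winds m times around the origin. *)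
Definition winds F (m : nat) :=
  exists u : R -> R, [/\ continuous u, u 0 = u (pi *+ 2) &
    forall t, F t = expi (t *+ m + u t)].

(** The quotient [w] of [G] by [F] stays in the right half-plane; its [atan] argument takes the same
    value at both ends and can be added to [u]. *)
Lemma winds_close F G m : continuous F -> continuous G ->
    (forall t, `|F t| = 1) -> (forall t, `|G t| = 1) ->
    F 0 = F (pi *+ 2) -> G 0 = G (pi *+ 2) ->
    (forall t, `|F t - G t| < 1) -> winds F m -> winds G m.
Proof.
move=> Fc Gc F1 G1 F0 G0 FG [u [uc u0 uF]].
pose w t := G t * (F t)^*.
have w1 t : `|w t| = 1 by rewrite normrM norm_conjC F1 G1 mulr1.
have Rw t : 0 < complex.Re (w t).
  have : `|1 - w t| < (1 : R)%:C%C.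
    have -> : 1 - w t = (F t - G t) * (F t)^* by rewrite mulrBl -normCK F1 expr1n.
    by rewrite normrM norm_conjC F1 mulr1; exact: FG.
  move=> /Re_norm_lt; case: (w t) => x y /=; rewrite ltr_norml => /andP[_]; lra.
have cw : continuous w.
  move=> t; exact: (cvgM (Gc t) (continuous_comp (Fc t) (@continuous_conj R _))).
exists (fun t => u t + atan (complex.Im (w t) / complex.Re (w t))); split.
- move=> t; apply: cvgD; first exact: uc.
  apply: continuous_comp; last exact: continuous_atan.
  apply: cvgM; first exact: (continuous_comp (cw t) (@continuous_Im R _)).
  apply: cvgV; first exact: lt0r_neq0.
  exact: (continuous_comp (cw t) (@continuous_Re R _)).
- by rewrite /w u0 F0 G0.
- move=> t; rewrite addrA expiD -uF.
  have := polar_half_plane (Rw t); rewrite w1 mul1r => <-.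
  by rewrite /w mulrCA -normCK F1 expr1n mulr1.
Qed.

(** The function [v] has [expi (v t) = 1] throughout but changes by [2 pi (n - m)] over a period. If
    [n] and [m] differed, it would at some point have moved by exactly [pi] or [- pi], where [expi]
    is -1. *)
Lemma winds_unique n m : winds (fun t => expi t ^+ n) m -> m = n.
Proof.
move=> [u [uc u0 uF]].
pose v t := t *+ n - t *+ m - u t.
have v1 t : expi (v t) = 1.
  have : expi (v t) * expi (t *+ m + u t) = expi t ^+ n.
    by rewrite -expiD -expi_nat; congr expi; rewrite /v; ring.
  rewrite uF => /(canRL (mulfK (expi_neq0 _))) ->; exact: divff (expi_neq0 _).
have vc : {within `[0, pi *+ 2], continuous v}.
  apply: continuous_subspaceT => t; apply: cvgB; last exact: uc.
  by apply: cvgB; apply: cvgMn; exact: cvg_id.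
have pi2 : 0 <= pi *+ 2 :> R by rewrite mulrn_wge0 // pi_ge0.
have no x : expi (v 0 + x) = -1 ->
    ~ (Num.min (v 0) (v (pi *+ 2)) <= v 0 + x <= Num.max (v 0) (v (pi *+ 2))).
  move=> ex /(IVT pi2 vc)[c _ vE]; have := v1 c; rewrite vE ex => /eqP.
  by rewrite eq_sym -subr_eq0 opprK -mulr2n pnatr_eq0.
have ev0 : v (pi *+ 2) = v 0 + (pi *+ 2 *+ n - pi *+ 2 *+ m).
  by rewrite /v -u0 !mul0rn; ring.
have epi : expi pi = -1 :> C.
  by apply/eqP; rewrite /expi cospi sinpi eq_complex /= oppr0 !eqxx.
have [mn|nm|//] := ltngtP m n.
- exfalso; apply: (no pi); first by rewrite expiD v1 mul1r epi.
  rewrite ge_min le_max; apply/andP; split; apply/orP; [left|right].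
    by rewrite lerDl pi_ge0.
  rewrite ev0 lerD2l -mulrnBr ?(ltnW mn) // -mulrnA -[X in X <= _]mulr1n.
  by rewrite ler_wpMn2l ?pi_ge0 // muln_gt0 subn_gt0.
- exfalso; apply: (no (- pi)); first by rewrite expiD v1 mul1r expiN epi rmorphN1.
  rewrite ge_min le_max; apply/andP; split; apply/orP; [right|left].
    rewrite ev0 lerD2l -[X in X <= _]opprB lerN2 -mulrnBr ?(ltnW nm) // -mulrnA.
    by rewrite -[X in X <= _]mulr1n ler_wpMn2l ?pi_ge0 // muln_gt0 subn_gt0.
  by rewrite gerDl oppr_le0 pi_ge0.
Qed.

(** * Homotopy invariance of the winding number *)

Definition homotopy_domain : set (R * C) := [set` `[0, 1]] `*` @unit_circle R.

Section Homotopy.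
Variable H : R * C -> C.
Hypothesis Hc : {within homotopy_domain, continuous H}.
Hypothesis H1 : forall x, homotopy_domain x -> `|H x| = 1.

Let K : set (R * R) := [set` `[0, 1]] `*` [set` `[- pi, pi]].
Let G (x : R * R) := H (x.1, expi x.2).

Let GcK x : K x -> G y @[y --> within K (nbhs x)] --> G x.
Proof.
move: x => [s t] [/= s01 tpi]; move/subspace_continuousP: Hc => Hc'.
have sD : homotopy_domain (s, expi t) by split=> //=; exact: norm_expi.
apply: cvg_comp (Hc' _ sD) => P /= wP.
have : (fun x : R * R => (x.1, expi x.2)) @ (s, t) --> (s, expi t).
  have h2 : (fun x : R * R => expi x.2) @ (s, t) --> expi t.
    exact: (cvg_comp _ _ (cvg_snd (F := nbhs s) (G := nbhs t)) (@continuous_expi R t)).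
  exact: (cvg_pair (cvg_fst (F := nbhs s) (G := nbhs t)) h2).
move=> /(_ _ wP); rewrite /= !near_simpl => h.
by apply: filterS h => -[s' t'] /= + [? _]; apply; split=> //=; exact: norm_expi.
Qed.

Lemma homotopy_slice_continuous s : 0 <= s <= 1 -> continuous (fun t => H (s, expi t)).
Proof.
move=> s01 t; move/subspace_continuousP: Hc => Hc'.
have sD t' : homotopy_domain (s, expi t').
  by split; [rewrite /= in_itv | exact: norm_expi].
apply: cvg_comp (Hc' _ (sD t)) => P /= wP.
have : (fun t => (s, expi t)) @ t --> (s, expi t).
  exact: (cvg_pair (cvg_cst (F := nbhs t) s) (@continuous_expi R t)).
by move=> /(_ _ wP); rewrite /= !near_simpl; apply: filterS => t' /=; apply.
Qed.

(** Continuity in [s] is uniform in [l] because the circle is the image of an interval and the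
    rectangle [K] is compact. The bound 1 is the one that [winds_close] asks for. *)
Lemma homotopy_uniform : exists2 d : R, 0 < d &
  forall (s s' : R) l, 0 <= s <= 1 -> 0 <= s' <= 1 -> `|l| = 1 -> `|s - s'| < d ->
    `|H (s, l) - H (s', l)| < 1.
Proof.
have cK : compact K by apply: compact_setX; exact: segment_compact.
have /(compact_near_coveringP K) nc := cK.
pose P (d : R) (x : R * R) := forall s', 0 <= s' <= 1 -> K x -> `|x.1 - s'| < d ->
  `|G x - G (s', x.2)| < 1.
have : \forall d \near (0 : R)^'+, K `<=` P d.
  apply: nc => -[s0 t0] Ks.
  have h2 : (0 : C) < 2^-1 by rewrite invr_gt0 ltr0n.
  have := GcK Ks; move=> /(_ _ (near_dist_lt (G (s0, t0)) h2)) /= [[A B] /= [nA nB]] AB.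
  move: nA => /nbhs_ballP[e /= e0 eA].
  have e20 : 0 < e / 2 by rewrite divr_gt0.
  exists ((ball s0 (e / 2) `*` B), [set d | d < e / 2]) => /=.
    split; first by exists (ball s0 (e / 2), B) => //=; split=> //; exact: nbhsx_ballx.
    exact: nbhs_right_lt.
  move=> [[s t] d] /= [[/= ss0 tB] de] s' s'01 Kst ss'.
  have As : A s by apply: eA; apply: le_ball ss0; rewrite ler_pdivrMr // ler_peMr ?ler1n // ltW.
  have As' : A s'.
    apply: eA; rewrite [e]splitr; apply: ball_triangle ss0 _.
    by rewrite -ball_normE /=; exact: lt_trans de.
  have Ks't : K (s', t) by case: Kst => /= _ ?; split; rewrite //= in_itv.
  have d1 := AB (s, t) (conj As tB) Kst; have d2 := AB (s', t) (conj As' tB) Ks't.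
  apply: le_lt_trans (ler_distD (G (s0, t0)) _ _) _.
  rewrite [ltRHS]splitr !div1r.
  by apply: ltrD d2; rewrite distrC; exact: d1.
move=> [e /= e0 eP]; exists (e / 2); first by rewrite divr_gt0.
move=> s s' l s01 s'01 l1 ss'.
have [t tpi ->] := circle_expi_itv l1.
have := eP (e / 2); rewrite /ball_ /= sub0r normrN ger0_norm; last by rewrite ltW // divr_gt0.
rewrite ltr_pdivrMr // ltr_pMr // ltr1n => /(_ isT).
rewrite divr_gt0 // => /(_ isT).
move=> /(_ (s, t)) /=; apply => //; split=> //=; by rewrite in_itv.
Qed.

(** The way from [a] to [b] is cut into [N > 1/d] equal steps, so consecutive slices differ by less
    than 1 and have the same winding number. *)
Lemma homotopy_winds (a b : R) m : 0 <= a <= 1 -> 0 <= b <= 1 ->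
  winds (fun t => H (a, expi t)) m -> winds (fun t => H (b, expi t)) m.
Proof.
move=> a01 b01 wa; have [d d0 Hd] := homotopy_uniform.
pose N := (Num.truncn d^-1).+1.
have dN : d^-1 < N%:R by exact: truncnS_gt.
pose s i := a + (b - a) * (i%:R / N%:R).
have sI i : (i <= N)%N -> 0 <= s i <= 1.
  move=> iN; have : 0 <= (i%:R / N%:R : R) <= 1.
    by rewrite divr_ge0 //= ler_pdivrMr ?ltr0n // mul1r ler_nat.
  rewrite /s; move: (_ / _) => x; move: a01 b01 => /andP[? ?] /andP[? ?] /andP[? ?].
  by apply/andP; split; nra.
have slice i : (i <= N)%N -> [/\ continuous (fun t => H (s i, expi t)),
    forall t, `|H (s i, expi t)| = 1 & H (s i, expi 0) = H (s i, expi (pi *+ 2))].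
  move=> iN; split; first exact/homotopy_slice_continuous/sI.
    by move=> t; apply: H1; split; [rewrite /= in_itv sI | exact: norm_expi].
  by rewrite expi0 expi2pi.
have all i : (i <= N)%N -> winds (fun t => H (s i, expi t)) m.
  elim: i => [_|i IH iN]; first by rewrite /s mul0r mulr0 addr0.
  have [c1 n1 e1] := slice i (ltnW iN); have [c2 n2 e2] := slice i.+1 iN.
  apply: (winds_close c1 c2 n1 n2 e1 e2) (IH (ltnW iN)) => t.
  apply: Hd; rewrite ?sI ?norm_expi // ?(ltnW iN) //.
  have -> : s i - s i.+1 = - ((b - a) / N%:R) by rewrite /s -natr1; ring.
  rewrite normrN normrM normfV [`|N%:R|]ger0_norm // ltr_pdivrMr ?ltr0n //.
  have : `|b - a| <= 1.
    by move: a01 b01 => /andP[? ?] /andP[? ?]; rewrite ler_norml; apply/andP; split; lra.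
  move/le_lt_trans; apply; rewrite mulrC -ltr_pdivrMr // mul1r //.
have := all N (leqnn _); rewrite /s divff ?pnatr_eq0 // mulr1.
by rewrite addrCA subrr addr0.
Qed.

End Homotopy.
(** Replacing [q.[l]] by [q.[(1 - s) l]] keeps the denominator away from 0 and ends at a constant
    multiple of [l ^+ n]; the factor [expi (- (s * theta))] meanwhile turns that constant into 1. *)
Lemma blaschke_homotopy n (kappa : C) (q : {poly C}) : zero_free q -> `|kappa| = 1 ->
  exists y : R * C -> C, [/\ {within homotopy_domain, continuous y},
    forall x, homotopy_domain x -> `|y x| = 1,
    forall l, `|l| = 1 -> y (0, l) = kappa * (l ^+ n * (q.[l])^*) / q.[l] &
    forall l, `|l| = 1 -> y (1, l) = l ^+ n].
Proof.
move=> qz k1.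
have q0 := zero_free0 qz.
have [theta thE] : exists theta, kappa * (q.[0])^* / q.[0] = expi theta.
  by apply: circle_expi; rewrite !normrM normfV norm_conjC k1 mul1r divff // normr_eq0.
pose w (x : R * C) := (1 - x.1)%:C%C * x.2.
pose y (x : R * C) := expi (- (x.1 * theta)) * kappa * (x.2 ^+ n * (q.[w x])^*) / q.[w x].
have qw x : homotopy_domain x -> q.[w x] != 0.
  case: x => s l [/=]; rewrite in_itv /= => /andP[s0 s1] l1; apply: qz.
  rewrite normrM l1 mulr1 normc_def /= expr0n addr0 sqrtr_sqr ger0_norm ?subr_ge0 //.
  by rewrite (lecR _ 1) gerBl.
exists y; split.
- apply: continuous_in_subspaceT => x /set_mem xD.
  have c1 : (fun x : R * C => x.1) @ x --> x.1 by case: (x) => s l; exact: cvg_fst.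
  have c2 : (fun x : R * C => x.2) @ x --> x.2 by case: (x) => s l; exact: cvg_snd.
  have cw : w @ x --> w x.
    apply: (cvgM (F := nbhs x)) c2.
    have c3 : (fun x : R * C => 1 - x.1) @ x --> 1 - x.1.
      by apply: (cvgB (F := nbhs x)) c1; exact: cvg_cst.
    exact: (continuous_comp c3 (@continuous_real_complex R _)).
  have cq : (fun x => q.[w x]) @ x --> q.[w x].
    exact: (continuous_comp cw (@continuous_complex_horner R q _)).
  have ce : (fun x : R * C => expi (- (x.1 * theta))) @ x --> expi (- (x.1 * theta)).
    have c3 : (fun x : R * C => - (x.1 * theta)) @ x --> - (x.1 * theta).
      by apply: (cvgN (F := nbhs x)); apply: (cvgM (F := nbhs x)) c1 _; exact: cvg_cst.
    exact: (continuous_comp c3 (@continuous_expi R _)).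
  have cn : (fun x : R * C => x.2 ^+ n) @ x --> x.2 ^+ n.
    rewrite (_ : (fun x => _) = (fun x : R * C => ('X^n : {poly C}).[x.2])); last first.
      by apply/funext => z; rewrite hornerXn.
    rewrite -[X in _ --> X]hornerXn.
    exact: (continuous_comp c2 (@continuous_complex_horner R 'X^n _)).
  apply: (cvgM (F := nbhs x)); last exact: (cvgV (F := nbhs x)) (qw _ xD) cq.
  apply: (cvgM (F := nbhs x)).
    by apply: (cvgM (F := nbhs x)) ce _; exact: cvg_cst.
  apply: (cvgM (F := nbhs x)) cn _.
  exact: (continuous_comp cq (@continuous_conj R _)).
- move=> x xD; have qx := qw x xD; case: x xD qx => s l [/= _ l1] qx.
  rewrite !normrM normfV norm_conjC normrX norm_expi k1 l1 expr1n !mul1r.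
  by rewrite divff // normr_eq0.
- move=> l l1; rewrite /y /w /= subr0 mul0r oppr0 expi0 mul1r.
  by rewrite (_ : (1%:C)%C = 1) // !mul1r.
- move=> l l1; rewrite /y /w /= mul1r subrr (_ : (0%:C)%C = 0) // mul0r.
  rewrite expiN; have := norm_expi theta; rewrite -thE => t1.
  transitivity (l ^+ n * ((kappa * (q.[0])^* / q.[0])^* * (kappa * (q.[0])^* / q.[0]))).
    by ring.
  by rewrite [_^* * _]mulrC -normCK t1 expr1n mulr1.
Qed.

Lemma blaschke_winds n (kappa : C) (q : {poly C}) : zero_free q -> `|kappa| = 1 ->
  winds (fun t => kappa * (expi t ^+ n * (q.[expi t])^*) / q.[expi t]) n.
Proof.
move=> qz k1; have [y [yc y1 y0 yn]] := blaschke_homotopy n qz k1.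
have h : winds (fun t => y (0, expi t)) n.
  apply: (homotopy_winds yc y1 (a := 1)); rewrite ?lexx ?ler01 //.
  exists (cst 0); split=> // [|t]; first exact: cst_continuous.
  by rewrite yn ?norm_expi // addr0 expi_nat.
have [u [uc u0 uE]] := h; exists u; split=> // t.
by rewrite -uE y0 ?norm_expi.
Qed.

End Winding.

(** * Normal forms of inner functions *)

Section Forms.
Variable R : realType.
Local Notation C := R[i].
Implicit Types (z w l : C) (t : R) (p q : {poly C}).

Lemma hausdorff_triple : hausdorff_space (C * C * C)%type.
Proof. exact: (@norm_hausdorff C (C * C * C)%type). Qed.

Lemma within_comp (U V : topologicalType) (A : set C) (f : C -> U) (g : U -> V) :
  continuous g -> {within A, continuous f} -> {within A, continuous (fun z => g (f z))}.
Proof.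
move=> gc /subspace_continuousP fc; apply/subspace_continuousP => z zA.
exact: cvg_comp (fc z zA) (gc _).
Qed.

Lemma continuous_proj1 : continuous (fun x : C * C * C => x.1.1).
Proof.
move=> [[x1 x2] x3] /=.
exact: (cvg_comp _ _ (cvg_fst (F := nbhs (x1, x2)) (G := nbhs x3))
  (cvg_fst (F := nbhs x1) (G := nbhs x2))).
Qed.

Lemma continuous_proj2 : continuous (fun x : C * C * C => x.1.2).
Proof.
move=> [[x1 x2] x3] /=.
exact: (cvg_comp _ _ (cvg_fst (F := nbhs (x1, x2)) (G := nbhs x3))
  (cvg_snd (F := nbhs x1) (G := nbhs x2))).
Qed.

Lemma continuous_proj3 : continuous (fun x : C * C * C => x.2).
Proof. by move=> [[x1 x2] x3] /=; exact: (cvg_snd (F := nbhs (x1, x2)) (G := nbhs x3)). Qed.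

Lemma norm_eq1 z : `|z| = 1 <-> complex.Re `|z| = 1.
Proof. by split=> [-> //|e]; rewrite norm_ReE e. Qed.

Lemma inner_circle (f : C -> C) :
    {within @closed_disc R, continuous f} ->
    ae_circle (fun l => exists2 y : C, `|y| = 1 & f (r%:C%C * l) @[r --> (1 : R)^'-] --> y) ->
  forall l, `|l| = 1 -> `|f l| = 1.
Proof.
move=> fc ae l l1; apply/norm_eq1/eqP; rewrite eq_le.
have c1 : continuous (fun z : C => complex.Re `|z| - 1).
  by move=> z; apply: (cvgB (F := nbhs z)); [exact: (@continuous_normc R z)|exact: cvg_cst].
have c2 : continuous (fun z : C => 1 - complex.Re `|z|).
  by move=> z; apply: (cvgB (F := nbhs z)); [exact: cvg_cst|exact: (@continuous_normc R z)].
have b1 (y : C) : `|y| = 1 -> complex.Re `|y| - 1 <= 0 by move=> /norm_eq1 ->; rewrite subrr.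
have b2 (y : C) : `|y| = 1 -> 1 - complex.Re `|y| <= 0 by move=> /norm_eq1 ->; rewrite subrr.
have := ae_circle_le (B := [set y | `|y| = 1]) (@hausdorffC R) fc c1 ae b1 l1.
have := ae_circle_le (B := [set y | `|y| = 1]) (@hausdorffC R) fc c2 ae b2 l1.
by rewrite !subr_le0 => -> ->.
Qed.

Lemma blaschke_solution_form n k (hkn : (k <= n)%N) (sigma eta : 'I_n -> C) (rho : 'I_k -> R)
    (f : C -> C) : blaschke_solution hkn sigma eta rho f ->
  exists kappa q, [/\ `|kappa| = 1, (size q <= n.+1)%N, zero_free q &
    forall z, closed_disc z -> f z = kappa * (revp n q).[z] / q.[z]].
Proof.
move=> [[_ _ ae fc] [p [q [cpq fpq dn]]] _ _].
have [qz fE] := coprime_continuous cpq fpq fc.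
have pq l : `|l| = 1 -> `|p.[l]| = `|q.[l]|.
  move=> l1; have lD : closed_disc l by rewrite /closed_disc /= l1.
  have := inner_circle fc ae l1; rewrite fE // normrM normfV => /(canRL (mulfVK _)) -> //.
    by rewrite mul1r.
  by rewrite normr_eq0 qz.
have [sq [kappa k1 pE]] := blaschke_form cpq qz pq dn.
by exists kappa, q; split=> // z zD; rewrite fE // pE hornerZ.
Qed.

Lemma blaschke_quotient_inner n (kappa : C) q : `|kappa| = 1 -> (size q <= n.+1)%N ->
    zero_free q -> (forall z, disc z -> `|kappa * (revp n q).[z]| <= `|q.[z]|) ->
  let f := fun z => (kappa *: revp n q).[z] / q.[z] in
  rational_inner f /\ rational_degree f n.
Proof.
move=> k1 sq qz le f.
have qd z : disc z -> q.[z] != 0 by move=> zD; apply: qz; exact: ltW.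
have k0 := unit_neq0 k1.
have fc : {within @closed_disc R, continuous f} by exact: quotient_within.
split; last first.
  exists (kappa *: revp n q), q; split=> //; first by rewrite coprimepZl // zero_free_coprime.
    by move=> z zD; split=> //; exact: qd.
  rewrite size_scale // (size_revp_eq n (zero_free0 qz)) /=.
  by apply/maxn_idPl; move: sq; case: (size q).
split=> //.
- by exists (kappa *: revp n q), q => z zD; split=> //; exact: qd.
- move=> z zD; rewrite /f hornerZ normrM normfV ler_pdivrMr ?normr_gt0 ?qd // mul1r.
  exact: le.
- apply: aeW => t; exists (f (expi t)).
    rewrite /f hornerZ normrM normfV normrM k1 mul1r norm_revp ?norm_expi // divff //.
    by rewrite normr_eq0 qz // norm_expi.
  exact: (closed_disc_radial fc (norm_expi t)).
Qed.

Lemma tetra_circle (x : C -> C * C * C) l : tetra_inner x -> `|l| = 1 ->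
  tetrablock_boundary (x l).
Proof.
move=> [_ _ ae xc] l1.
have cn (g : C * C * C -> C) : continuous g -> continuous (fun y => complex.Re `|g y|).
  by move=> gc y; exact: (continuous_comp (gc y) (@continuous_normc R _)).
have le (h : C * C * C -> R) : continuous h -> (forall y, tetrablock_boundary y -> h y <= 0) ->
    h (x l) <= 0.
  by move=> hc hB; exact: (ae_circle_le hausdorff_triple xc hc ae hB l1).
split.
- have gc : continuous (fun y : C * C * C => y.1.1 - y.1.2^* * y.2).
    move=> y; have cc := continuous_comp (@continuous_proj2 y) (@continuous_conj R _).
    exact: (cvgB (@continuous_proj1 y) (cvgM cc (@continuous_proj3 y))).
  have := le _ (cn _ gc); rewrite /= => h0.
  apply/eqP; rewrite -subr_eq0 -normr_le0 norm_ReE (lecR _ 0); apply: h0 => y [-> _ _].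
  by rewrite subrr Normc.normc0.
- apply/norm_eq1/eqP; rewrite eq_le -subr_le0 -[X in _ && X]subr_le0.
  apply/andP; split.
    apply: (le (fun y => complex.Re `|y.2| - 1)) => [y|y [_ /norm_eq1 -> _]]; last by rewrite subrr.
    by apply: (cvgB (F := nbhs y)); [exact: (cn _ continuous_proj3)|exact: cvg_cst].
  apply: (le (fun y => 1 - complex.Re `|y.2|)) => [y|y [_ /norm_eq1 -> _]]; last by rewrite subrr.
  by apply: (cvgB (F := nbhs y)); [exact: cvg_cst|exact: (cn _ continuous_proj3)].
- rewrite norm_ReE (lecR _ 1) -subr_le0.
  apply: (le (fun y => complex.Re `|y.1.2| - 1)) => [y|y [_ _ +]].
    by apply: (cvgB (F := nbhs y)); [exact: (cn _ continuous_proj2)|exact: cvg_cst].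
  by rewrite norm_ReE (lecR _ 1) subr_le0.
Qed.

Definition tetra_map n (kappa : C) (q E : {poly C}) (z : C) : C * C * C :=
  (kappa * (revp n E).[z] / q.[z], E.[z] / q.[z], kappa * (revp n q).[z] / q.[z]).

Lemma tetra_form n (x : C -> C * C * C) : tetra_inner x -> tetra_degree x n ->
  exists (kappa : C) (q E : {poly C}), [/\
    [/\ `|kappa| = 1, zero_free q, (size q <= n.+1)%N & (size E <= n.+1)%N],
    forall l, `|l| = 1 -> `|E.[l]| <= `|q.[l]| &
    forall z, closed_disc z -> x z = tetra_map n kappa q E z].
Proof.
move=> xi [H [Hc HB H0 H1]].
have bd l : `|l| = 1 ->
    [/\ (x l).1.1 = (x l).1.2^* * (x l).2, `|(x l).2| = 1 & `|(x l).1.2| <= 1].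
  exact: tetra_circle.
have [[ra1 ra2 ra3] _ _ xc] := xi.
have [p1 [q1 [c1 z1 f1]]] := rational_closed_disc ra1 (within_comp continuous_proj1 xc).
have [p2 [q2 [c2 z2 f2]]] := rational_closed_disc ra2 (within_comp continuous_proj2 xc).
have [p3 [q [c3 qz f3]]] := rational_closed_disc ra3 (within_comp continuous_proj3 xc).
have {}f1 z : closed_disc z -> (x z).1.1 = p1.[z] / q1.[z] := f1 z.
have {}f2 z : closed_disc z -> (x z).1.2 = p2.[z] / q2.[z] := f2 z.
have {}f3 z : closed_disc z -> (x z).2 = p3.[z] / q.[z] := f3 z.
have cd l : `|l| = 1 -> closed_disc l by move=> l1; rewrite /closed_disc /= l1.
have pq l : `|l| = 1 -> `|p3.[l]| = `|q.[l]|.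
  move=> l1; have [_ + _] := bd l l1.
  rewrite (f3 _ (cd _ l1)) normf_div => /(canRL (divfK _)) -> //; first by rewrite mul1r.
  by rewrite normr_eq0 qz // l1.
have [sq [kappa k1 p3E]] := blaschke_form c3 qz pq (erefl _).
set m := maxn _ _ in sq p3E.
have k0 := unit_neq0 k1.
have x3E l : `|l| = 1 -> (x l).2 = kappa * (revp m q).[l] / q.[l].
  by move=> l1; rewrite (f3 _ (cd _ l1)) p3E hornerZ.
(* The third component of the homotopy joins [x3], which winds [m] times by its Blaschke form, to
   the loop [l ^+ n]. *)
have mn : m = n.
  apply: winds_unique.
  have w0 := blaschke_winds m qz k1.
  pose H3 y := (H y).2.
  have H3c : {within @homotopy_domain R, continuous H3}.
    move/subspace_continuousP: Hc => Hc; apply/subspace_continuousP => y yD.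
    exact: cvg_comp (Hc y yD) (@continuous_proj3 _).
  have H31 y : homotopy_domain y -> `|H3 y| = 1.
    case: y => s l [/= s01 l1]; have [|//|_ + _] := HB s l; first by move: s01; rewrite in_itv.
    by [].
  have h : winds (fun t => H3 (1, expi t)) m.
    apply: (homotopy_winds H3c H31 (a := 0)); rewrite ?lexx ?ler01 //.
    have [u [uc u0 uE]] := w0; exists u; split=> // t.
    rewrite -uE /H3 H0 ?x3E; try exact: norm_expi.
    by rewrite horner_revp_circle // norm_expi.
  have [u [uc u0 uE]] := h; exists u; split=> // t.
  by rewrite -uE /H3 H1 //; exact: norm_expi.
rewrite mn in sq x3E p3E => {m mn}.
(* On the boundary [x1] is the conjugate of [x2] times [x3], and symmetrically for [x2] since
   [|x3| = 1]. Each relation lets the denominator of one component be replaced by [q]. *)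
have [E1 e1 E1c] : exists2 E1, p1 * q = E1 * q1 &
    forall l, `|l| = 1 -> p1.[l] / q1.[l] = E1.[l] / q.[l].
  apply: (common_denominator sq qz c1 z1 z2 (p2 := p2) (kappa := kappa)) => l l1.
  by have [+ _ _] := bd l l1; rewrite x3E // (f1 _ (cd _ l1)) (f2 _ (cd _ l1)).
have [E e2 Ec] : exists2 E, p2 * q = E * q2 &
    forall l, `|l| = 1 -> p2.[l] / q2.[l] = E.[l] / q.[l].
  apply: (common_denominator sq qz c2 z2 z1 (p2 := p1) (kappa := kappa)) => l l1.
  have [+ + _] := bd l l1; rewrite -x3E // -(f1 _ (cd _ l1)) -(f2 _ (cd _ l1)) => -> x31.
  by rewrite rmorphM /= conjCK -mulrA [_ * (x l).2]mulrC -normCK x31 expr1n mulr1.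
(* No bound on the degree of [E] is known so far; this reciprocal relation with the polynomial [E1]
   supplies it. *)
have EE l : `|l| = 1 -> E1.[l] = kappa * (l ^+ n * (E.[l])^*).
  move=> l1; have [+ _ _] := bd l l1; rewrite x3E // (f1 _ (cd _ l1)) (f2 _ (cd _ l1)) E1c // Ec //.
  have q0 : q.[l] != 0 by apply: qz; rewrite l1.
  have qc0 : (q.[l])^* != 0 by rewrite conjC_eq0.
  rewrite rmorphM fmorphV /= horner_revp_circle // => /(canRL (divfK q0)) ->.
  by field; rewrite q0 qc0.
have [sE E1E] := size_reciprocal k0 EE.
exists kappa, q, E; split=> // [l l1|z zD].
  have [_ _] := bd l l1; rewrite (f2 _ (cd _ l1)) Ec // normf_div ler_pdivrMr ?mul1r //.
  by rewrite normr_gt0 qz // l1.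
have q0 : q.[z] != 0 by exact: qz.
have := f1 z zD; have := f2 z zD; have := f3 z zD; case: (x z) => [[y1 y2] y3] /= -> -> ->.
rewrite /tetra_map p3E hornerZ; congr (_, _, _).
  have q10 : q1.[z] != 0 by exact: z1.
  apply/eqP; rewrite eqr_div //; move/(congr1 (fun r => r.[z])): e1.
  by rewrite !hornerM E1E hornerZ => ->.
have q20 : q2.[z] != 0 by exact: z2.
by apply/eqP; rewrite eqr_div //; move/(congr1 (fun r => r.[z])): e2; rewrite !hornerM => ->.
Qed.

Lemma tetra_map_boundary n (kappa : C) (q E : {poly C}) l : `|kappa| = 1 -> zero_free q ->
    (size q <= n.+1)%N -> (size E <= n.+1)%N -> `|l| = 1 -> `|E.[l]| <= `|q.[l]| ->
  tetrablock_boundary (tetra_map n kappa q E l).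
Proof.
move=> k1 qz sq sE l1 le; have q0 : q.[l] != 0 by apply: qz; rewrite l1.
have qc0 : (q.[l])^* != 0 by rewrite conjC_eq0.
split=> /=.
- rewrite !horner_revp_circle // rmorphM fmorphV /=; field; by rewrite q0 qc0.
- by rewrite !normrM normfV k1 mul1r norm_revp // divff // normr_eq0.
- by rewrite normrM normfV ler_pdivrMr ?normr_gt0 // mul1r.
Qed.

Lemma tetra_map_inner n (kappa : C) (q E : {poly C}) : `|kappa| = 1 -> zero_free q ->
    (size q <= n.+1)%N -> (size E <= n.+1)%N ->
    (forall l, `|l| = 1 -> `|E.[l]| <= `|q.[l]|) ->
    (forall z, disc z -> closed_tetrablock (tetra_map n kappa q E z)) ->
  tetra_inner (tetra_map n kappa q E) /\ tetra_degree (tetra_map n kappa q E) n.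
Proof.
move=> k1 qz sq sE le tb.
have qd z : disc z -> q.[z] != 0 by move=> zD; apply: qz; exact: ltW.
have xc : {within @closed_disc R, continuous (tetra_map n kappa q E)}.
  apply: continuous_in_subspaceT => z /set_mem zD.
  have qzz : q.[z] != 0 by exact: qz.
  have c (p : {poly C}) : (fun z => p.[z] / q.[z]) @ z --> p.[z] / q.[z].
    exact: (continuous_quotient qzz).
  have -> : tetra_map n kappa q E = fun z => ((kappa *: revp n E).[z] / q.[z], E.[z] / q.[z],
      (kappa *: revp n q).[z] / q.[z]).
    by apply/funext => w; rewrite /tetra_map !hornerZ.
  exact: (cvg_pair (cvg_pair (c _) (c _)) (c _)).
split; [split=> //|].
- split; [exists (kappa *: revp n E), q|exists E, q|exists (kappa *: revp n q), q] => z zD /=;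
    by rewrite ?hornerZ; split=> //; exact: qd.
- apply: aeW => t; exists (tetra_map n kappa q E (expi t)).
    by apply: tetra_map_boundary => //; rewrite ?norm_expi // le // norm_expi.
  exact: (closed_disc_radial xc (norm_expi t)).
have [y [yc y1 y0 yn]] := blaschke_homotopy n qz k1.
(* The second and third coordinates parametrize the boundary, so [x2] is shrunk to 0 and [x3]
   deformed to [l ^+ n] independently, and the first coordinate is computed from them. *)
pose e (v : R * C) := (1 - v.1)%:C%C * (E.[v.2] / q.[v.2]).
exists (fun v => ((e v)^* * y v, e v, y v)); split.
- apply/subspace_continuousP => v vD.
  have cy : y v' @[v' --> within (@homotopy_domain R) (nbhs v)] --> y v.
    by move/subspace_continuousP: yc; apply.
  have ce : e v' @[v' --> within (@homotopy_domain R) (nbhs v)] --> e v.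
    apply: cvg_within_filter.
    have c1 : (fun v : R * C => v.1) @ v --> v.1 by case: (v) => s l; exact: cvg_fst.
    have c2 : (fun v : R * C => v.2) @ v --> v.2 by case: (v) => s l; exact: cvg_snd.
    have c3 : (fun v : R * C => 1 - v.1) @ v --> 1 - v.1.
      by apply: (cvgB (F := nbhs v)) c1; exact: cvg_cst.
    have qv : q.[v.2] != 0 by apply: qz; case: vD => _ ->.
    have c4 : (fun v : R * C => E.[v.2] / q.[v.2]) @ v --> E.[v.2] / q.[v.2].
      exact: (continuous_comp c2 (continuous_quotient (p := E) qv)).
    exact: (cvgM (continuous_comp c3 (@continuous_real_complex R _)) c4).
  exact: (cvg_pair (cvg_pair (cvgM (cvg_comp _ _ ce (@continuous_conj R _)) cy) ce) cy).
- move=> s l s01 l1; split=> //=; first by apply: y1; split; rewrite //= in_itv.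
  move: s01 => /andP[s0 s1].
  rewrite normrM normc_def /= expr0n addr0 sqrtr_sqr ger0_norm ?subr_ge0 //.
  rewrite mulr_ile1 ?normr_ge0 //; first by rewrite (lecR 0) subr_ge0.
    by rewrite (lecR _ 1) gerBl.
  by rewrite normrM normfV ler_pdivrMr ?normr_gt0 ?mul1r ?le // qz // l1.
- move=> l l1; have [b1 _ _] := tetra_map_boundary k1 qz sq sE l1 (le l l1).
  have e0 : e (0, l) = (tetra_map n kappa q E l).1.2.
    by rewrite /e /= subr0 (_ : (1%:C)%C = 1) // mul1r.
  have y30 : y (0, l) = (tetra_map n kappa q E l).2 by rewrite y0 //= horner_revp_circle.
  by rewrite e0 y30 -b1.
- move=> l l1; have e0 : e (1, l) = 0 by rewrite /e /= subrr (_ : (0%:C)%C = 0) // mul0r.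
  by rewrite e0 conjC0 mul0r yn.
Qed.

End Forms.

(** * From royal to Blaschke interpolation *)

Section Forward.
Variable R : realType.
Local Notation C := R[i].
Variables (n k : nat) (hkn : (k <= n)%N).
Variables (sigma eta etat : 'I_n -> C) (rho : 'I_k -> R).
Hypothesis hdata : royal_data sigma eta etat rho.
Variables (kappa : C) (q E : {poly C}).
Hypotheses (k1 : `|kappa| = 1) (qz : zero_free q).
Hypotheses (sq : (size q <= n.+1)%N) (sE : (size E <= n.+1)%N).
Hypothesis le : forall l, `|l| = 1 -> `|E.[l]| <= `|q.[l]|.
Let x := tetra_map n kappa q E.
Hypothesis tb : forall z, closed_disc z -> closed_tetrablock (x z).
Hypothesis interp : forall j, x (sigma j) = (eta j, etat j, eta j * etat j).

Definition royal_polynomial := q * revp n q - E * revp n E.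
Let P := royal_polynomial.

Let k0 : kappa != 0. Proof. exact: unit_neq0. Qed.

Lemma royal_polynomial_root z : closed_disc z ->
  root P z <-> (x z).2 = (x z).1.1 * (x z).1.2.
Proof.
move=> zD; have q0 : q.[z] != 0 by exact: qz.
have e : (x z).2 - (x z).1.1 * (x z).1.2 = kappa / q.[z] ^+ 2 * P.[z].
  by rewrite /x /tetra_map /P /royal_polynomial !hornerE /=; field.
have n0 : kappa / q.[z] ^+ 2 != 0 by rewrite mulf_neq0 // invr_eq0 expf_neq0.
split=> [/rootP Pz|/eqP]; first by apply/eqP; rewrite -subr_eq0 e Pz mulr0.
by rewrite -subr_eq0 e mulf_eq0 (negbTE n0).
Qed.

Lemma node_closed_disc j : closed_disc (sigma j).
Proof.
have [[_ _ h _ _] _] := hdata; have := h j; rewrite /closed_disc /=.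
by case: ifP => _ => [->|/ltW].
Qed.

Lemma circle_node j : `|sigma j| = 1 -> exists2 i : 'I_k, j = widen_ord hkn i &
  [/\ `|eta j| = 1 & `|etat j| = 1].
Proof.
move=> s1; have [[_ _ hs he _] ht] := hdata.
have := hs j; have := he j; have := ht j; case: ifP => [jk|_]; last by rewrite s1 ltxx.
by move=> t1 e1 _; exists (Ordinal jk) => //; apply: val_inj.
Qed.

Lemma node_values j : [/\ q.[sigma j] != 0, E.[sigma j] = etat j * q.[sigma j],
  kappa * (revp n E).[sigma j] = eta j * q.[sigma j] &
  kappa * (revp n q).[sigma j] = eta j * etat j * q.[sigma j]].
Proof.
have q0 : q.[sigma j] != 0 by apply: qz; exact: node_closed_disc.
have [/(canRL (divfK q0)) e1 /(canRL (divfK q0)) e2 /(canRL (divfK q0)) e3] := interp j.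
by split.
Qed.

Lemma node_root j : root P (sigma j).
Proof.
by apply/royal_polynomial_root; [exact: node_closed_disc | rewrite interp].
Qed.

Lemma node_contact j : `|sigma j| = 1 -> `|E.[sigma j]| = `|q.[sigma j]|.
Proof.
move=> s1; have [_ -> _ _] := node_values j; have [_ _ [_ t1]] := circle_node s1.
by rewrite normrM t1 mul1r.
Qed.

(** A contact point [tau] is itself a double zero of [P]; added to the [n] nodes it exceeds what the
    degree allows. *)
Lemma royal_polynomial_eq0 tau : `|tau| = 1 -> (forall i : 'I_k, tau != sigma (widen_ord hkn i)) ->
  `|E.[tau]| = `|q.[tau]| -> P = 0.
Proof.
move=> t1 ts tE.
have sP : (size P <= n.*2.+1)%N.
  rewrite -addnn; apply: leq_trans (size_polyD _ _) _; rewrite geq_max size_polyN.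
  by rewrite !size_mul_leS ?size_revp.
have rP : revp n.*2 P = P.
  rewrite /P /royal_polynomial -addnn revpB !revpM ?size_revp // !revpK //.
  by rewrite mulrC [_ * E]mulrC.
apply: (self_reciprocal_eq0 (s := tau :: [seq sigma j | j <- enum 'I_n]) sP rP).
- have [[_ si _ _ _] _] := hdata.
  rewrite /= map_inj_uniq // enum_uniq andbT; apply/mapP => -[j _ tj].
  have [|i ji _] := @circle_node j; first by rewrite -tj.
  by have := ts i; rewrite -ji tj eqxx.
- by rewrite /= size_map size_enum_ord.
- move=> z; rewrite inE => /predU1P[->|/mapP[j _ ->]].
    split=> [||_]; first by rewrite t1.
      apply/royal_polynomial_root; first by rewrite /closed_disc /= t1.
      have [-> _ _] := tetra_map_boundary k1 qz sq sE t1 (le t1).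
      have q0 : q.[tau] != 0 by apply: qz; rewrite t1.
      have e1 : `|(x tau).1.2| = 1 by rewrite normf_div tE divff // normr_eq0.
      by rewrite -/x mulrAC [_^* * _]mulrC -normCK e1 expr1n mul1r.
    exact: contact_double_root.
  split; [exact: node_closed_disc|exact: node_root|] => s1.
  exact: (contact_double_root le s1 (node_contact s1)).
Qed.

Local Notation Q omega := (omega *: E - q).

(** At such a point [omega * x2 = 1], and the tetrablock inequality at [w = omega] has right-hand
    side 0, so [x1 = x3 * omega]; multiplied by [x2] this is the royal equation. *)
Lemma bad_root omega z : `|omega| = 1 -> closed_disc z -> (Q omega).[z] = 0 -> root P z.
Proof.
move=> w1 zD; rewrite !hornerE => /subr0_eq e.
have q0 : q.[z] != 0 by exact: qz.
apply/royal_polynomial_root => //.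
have ox : omega * (x z).1.2 = 1 by rewrite /x /= mulrA e divff.
have [_ /(_ omega)] := tetrablock_bounds (tb zD); rewrite w1 lexx => /(_ isT).
rewrite [_.1.2 * omega]mulrC ox subrr normr0 normr_le0 subr_eq0 => /eqP ->.
by rewrite -mulrA ox mulr1.
Qed.

Hypothesis P0 : P != 0.

(** An excluded [omega] equals [q.[r] / E.[r]] for one of the finitely many roots [r] of [P]. The
    list [L] makes it possible to choose a second parameter different from the first. *)
Lemma good_parameter (L : seq C) :
  exists omega, [/\ `|omega| = 1, omega \notin L & zero_free (Q omega)].
Proof.
have [rs Prs] : exists rs : seq C, forall z, root P z -> z \in rs.
  have [rs Prs] := closed_field_poly_normal P; exists rs => z.
  by rewrite Prs rootZ ?lead_coef_eq0 // root_prod_XsubC.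
have [omega [w1 wL _]] := @circle_avoid R (L ++ [seq q.[r] / E.[r] | r <- rs]) 1 1 (normr1 _) ltr01.
exists omega; split=> //; first by move: wL; rewrite mem_cat negb_or => /andP[].
move=> z zD; apply: contra wL => /eqP Qz; rewrite mem_cat; apply/orP; right.
apply/mapP; exists z; first by apply: Prs; exact: bad_root Qz.
move: Qz; rewrite !hornerE => /subr0_eq e.
have Ez : E.[z] != 0 by apply: contraNneq (qz zD) => Ez; rewrite -e Ez mulr0.
by rewrite -e mulfK.
Qed.

Hypothesis phasar : forall i : 'I_k,
  is_phasar_derivative (fun z => (x z).1.1) (sigma (widen_ord hkn i)) (rho i).

Lemma good_solution omega : `|omega| = 1 -> zero_free (Q omega) ->
  blaschke_solution hkn sigma eta rho
    (fun z => ((- omega * kappa) *: revp n (Q omega)).[z] / (Q omega).[z]).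
Proof.
move=> w1 Qz.
have sQ : (size (Q omega) <= n.+1)%N.
  apply: leq_trans (size_polyD _ _) _; rewrite geq_max size_polyN sq andbT.
  exact: leq_trans (size_scale_leq _ _) sE.
(* Since [|omega| = 1], the numerator divided by [q] is [omega * x3 - x1], so the tetrablock
   inequality at [w = omega] bounds the fraction by 1. *)
have num : (- omega * kappa) *: revp n (Q omega) = omega *: (kappa *: revp n q) - kappa *: revp n E.
  rewrite revpB revpZ; apply/polyP => i; rewrite !(coefZ, coefB).
  have oo : omega * omega^* = 1 by rewrite -normCK w1 expr1n.
  transitivity (kappa * (omega * (revp n q)`_i - omega * omega^* * (revp n E)`_i)); first by ring.
  by rewrite oo; ring.
have kk1 : `|- omega * kappa| = 1 by rewrite normrM normrN w1 k1 mulr1.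
have le1 z : disc z -> `|- omega * kappa * (revp n (Q omega)).[z]| <= `|(Q omega).[z]|.
  move=> zD1; have zD : closed_disc z by exact: ltW.
  have q0 : q.[z] != 0 by exact: qz.
  rewrite -hornerZ num; have [_ /(_ omega)] := tetrablock_bounds (tb zD).
  rewrite w1 lexx distrC (distrC 1) => /(_ isT).
  rewrite (_ : (x z).2 * omega - (x z).1.1 =
    (omega *: (kappa *: revp n q) - kappa *: revp n E).[z] / q.[z]); last first.
    by rewrite /x /= hornerD hornerN !hornerZ; field.
  rewrite (_ : (x z).1.2 * omega - 1 = (Q omega).[z] / q.[z]); last first.
    by rewrite /x /= hornerD hornerN hornerZ; field.
  by rewrite !normf_div ler_pM2r ?invr_gt0 ?normr_gt0.
have [inn deg] := blaschke_quotient_inner kk1 sQ Qz le1.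
split=> //.
  move=> j; have [q0 eE eR eN] := node_values j.
  have Qj : (Q omega).[sigma j] != 0 by apply: Qz; exact: node_closed_disc.
  apply/eqP; rewrite -(inj_eq (mulIf Qj)) divfK //; apply/eqP.
  rewrite num !(hornerD, hornerN, hornerZ) eR eN eE. ring.
move=> i; set s := sigma _.
have s1 : `|s| = 1.
  have [[_ _ hs _ _] _] := hdata; have := hs (widen_ord hkn i).
  by rewrite /= ltn_ord.
have [_ _ [h1 t1]] := circle_node s1.
have [q0 eE eR eN] := node_values (widen_ord hkn i); rewrite -/s in q0 eE eR eN.
set h := eta _ in eR eN h1; set h' := etat _ in eE eN t1.
have h0 : h != 0 by exact: unit_neq0.
have s0 : s != 0 by exact: unit_neq0.
have Qs : (Q omega).[s] != 0 by apply: Qz; rewrite s1.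
(* At a royal node numerator and denominator share the factor [omega * h' - 1], so [omega] drops out
   of the value. *)
have QE : (Q omega).[s] = q.[s] * (omega * h' - 1) by rewrite hornerD hornerN hornerZ eE; ring.
have w0 : omega * h' - 1 != 0 by apply: contraNneq Qs => w0; rewrite QE w0 mulr0.
pose p1 := kappa *: revp n E.
have p1s : p1.[s] = h * q.[s] by rewrite /p1 hornerZ.
have p1s0 : p1.[s] != 0 by rewrite p1s mulf_neq0.
have Es : `|p1.[s]| = `|q.[s]| by rewrite p1s normrM h1 mul1r.
have le2 z : `|z| = 1 -> `|p1.[z]| <= `|q.[z]|.
  by move=> z1; rewrite /p1 hornerZ normrM k1 mul1r norm_revp // le.
have r1 : log_derivative p1 q s = (rho i)%:C%C.
  have f1 z : `|z| = 1 -> (x z).1.1 = p1.[z] / q.[z] by rewrite /x /= /p1 hornerZ.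
  have /(@phasar_derivativeP R _ _ _ _ _ f1 s1 p1s0 q0) <- := phasar i.
  by rewrite RRe_real // log_derivative_real.
set f := fun z => _.
apply/(@phasar_derivativeP R _ _ f _ _ (fun z _ => erefl) s1 _ Qs).
  have -> : ((- omega * kappa) *: revp n (Q omega)).[s] = h * q.[s] * (omega * h' - 1).
    by rewrite num hornerD hornerN !hornerZ eR eN; ring.
  by rewrite !mulf_neq0.
suff -> : log_derivative ((- omega * kappa) *: revp n (Q omega)) (Q omega) s = (rho i)%:C%C by [].
(* The vanishing derivative of [P] at the node is the identity that removes [omega] from the
   logarithmic derivative and leaves that of [x1]. *)
have /rootP := contact_double_root le s1 (node_contact s1) sE sq.
rewrite -/s derivB !derivM !(hornerD, hornerN, hornerM) eE.
have kR : (revp n E).[s] = kappa^-1 * (h * q.[s]) by rewrite -eR mulKf.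
have kN : (revp n q).[s] = kappa^-1 * (h * h' * q.[s]) by rewrite -eN mulKf.
rewrite kR kN => dP.
rewrite -r1 /log_derivative p1s QE num.
have -> : (omega *: (kappa *: revp n q) - kappa *: revp n E).[s] = h * q.[s] * (omega * h' - 1).
  by rewrite hornerD hornerN !hornerZ eR eN; ring.
rewrite /p1 !derivB !derivZ !(hornerD, hornerN, hornerZ).
have e1 : (revp n q)^`().[s] * q.[s] = E^`().[s] * (kappa^-1 * (h * q.[s])) +
    h' * q.[s] * (revp n E)^`().[s] - q^`().[s] * (kappa^-1 * (h * h' * q.[s])).
  apply/eqP; rewrite -subr_eq0 -dP; apply/eqP; ring.
have -> : (revp n q)^`().[s] = E^`().[s] * (kappa^-1 * h) +
    h' * (revp n E)^`().[s] - q^`().[s] * (kappa^-1 * (h * h')).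
  by apply: (mulIf q0); rewrite e1; ring.
by field; rewrite q0 k0 h0 w0.
Qed.

End Forward.

Section ForwardTheorem.
Variable R : realType.
Local Notation C := R[i].

Lemma phasar_derivative_eq (f g : C -> C) l (r : R) : (forall z, `|z| = 1 -> f z = g z) ->
  is_phasar_derivative f l r -> is_phasar_derivative g l r.
Proof.
move=> fg [t0 [u [tl near_f du]]]; exists t0, u; split=> //.
by apply: filterS near_f => t; rewrite fg //; exact: norm_expi.
Qed.

Lemma royal_to_blaschke (n k : nat) (hkn : (k <= n)%N)
    (sigma eta etat : 'I_n -> C) (rho : 'I_k -> R)
    (hdata : royal_data sigma eta etat rho) (a b c d : {poly C})
    (hparam : blaschke_solvable hkn sigma eta rho ->
              normalized_parametrization hkn sigma eta rho a b c d)
    (x : C -> C * C * C) :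
  royal_solution hkn sigma eta etat rho x ->
  ~ (x @` @closed_disc R `<=` @royal_variety R) ->
  blaschke_solvable hkn sigma eta rho /\
   exists x1 x2 x3 : C,
     [/\ `|x3| = 1, `|x1| < 1, `|x2| < 1, x1 = x2^* * x3 &
         forall j : 'I_n,
           (x3 * c.[sigma j] + x2 * d.[sigma j]) /
           (x1 * c.[sigma j] + d.[sigma j]) = etat j].
Proof.
move=> [xi xd xint xph] nr.
have [kappa [q [E [[k1 qz sq sE] le xE]]]] := tetra_form xi xd.
have cd (l : C) : `|l| = 1 -> closed_disc l by move=> l1; rewrite /closed_disc /= l1.
have k0 := unit_neq0 k1.
set y := tetra_map n kappa q E in xE.
have tb z : closed_disc z -> closed_tetrablock (y z).
  move=> zD; move: (zD); rewrite /closed_disc /= le_eqVlt => /predU1P[z1|z1].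
    by apply: boundary_closed_tetrablock; apply: tetra_map_boundary => //; exact: le.
  by rewrite -xE //; case: xi => _ + _ _; apply.
have interp j : y (sigma j) = (eta j, etat j, eta j * etat j).
  by rewrite -xE; [exact: xint | exact: (node_closed_disc hdata)].
have P0 : royal_polynomial n q E != 0.
  apply: contra_notN nr => /eqP P0 _ [z zD <-]; rewrite xE //; split; first exact: tb.
  by apply/(royal_polynomial_root n E k1 qz zD); rewrite P0 root0.
have yph i : is_phasar_derivative (fun z => (y z).1.1) (sigma (widen_ord hkn i)) (rho i).
  by apply: phasar_derivative_eq (xph i) => z z1; rewrite (xE _ (cd _ z1)).
(* Two distinct parameters are kept, because the identity [key] below is affine in [om]. *)
have [w [w1 _ Qw]] := good_parameter k1 qz tb P0 [::].
have [v [v1 vw Qv]] := good_parameter k1 qz tb P0 [:: w].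
have solw := good_solution hdata k1 qz sq sE le tb interp yph w1 Qw.
have solv := good_solution hdata k1 qz sq sE le tb interp yph v1 Qv.
have bs : blaschke_solvable hkn sigma eta rho by eexists; exact: solw.
split=> //.
have [[sa sb _ _] _ [tau [t1 ts [ta tb' tc td]]] param] := hparam bs.
have qt : q.[tau] != 0 by apply: qz; rewrite t1.
exists (y tau).1.1, (y tau).1.2, (y tau).2.
have [y1E y31 y21] := tetra_map_boundary k1 qz sq sE t1 (le _ t1).
have Et : `|E.[tau]| != `|q.[tau]|.
  by apply: contra_neq P0 => Et; exact: (royal_polynomial_eq0 hdata k1 qz sq sE le interp t1 ts).
have y2lt : `|(y tau).1.2| < 1.
  rewrite lt_neqAle y21 andbT; apply: contra Et => /eqP.
  by rewrite normf_div => /(canRL (divfK _)) ->; rewrite ?mul1r ?normr_eq0.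
split=> //.
  by rewrite y1E normrM norm_conjC y31 mulr1.
(* The solution attached to [om] equals the parametrized one for some [zeta]. The denominator
   [zeta *: c + d] has value 1 at [tau], which determines the factor of proportionality, and [zeta]
   is the value of the solution at [tau]. *)
have key om : `|om| = 1 -> zero_free (om *: E - q) ->
    blaschke_solution hkn sigma eta rho
      (fun z => ((- om * kappa) *: revp n (om *: E - q)).[z] / (om *: E - q).[z]) ->
  forall z, c.[z] * (om * (y tau).2 - (y tau).1.1) + d.[z] * (om * (y tau).1.2 - 1) =
    (om *: E - q).[z] / q.[tau].
  move=> om1 Qz sol z; set Q := om *: E - q.
  have sQ : (size Q <= n.+1)%N.
    apply: leq_trans (size_polyD _ _) _; rewrite geq_max size_polyN sq andbT.
    exact: leq_trans (size_scale_leq _ _) sE.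
  have [zeta zeta1 fE] := param _ sol.
  have om0 : - om * kappa != 0 by rewrite mulf_neq0 // oppr_eq0 unit_neq0.
  have At : (zeta *: a + b).[tau] = zeta by rewrite !hornerE ta tb' mulr1 addr0.
  have Bt : (zeta *: c + d).[tau] = 1 by rewrite !hornerE tc td mulr0 add0r.
  have sA : (size (zeta *: a + b)%R <= n.+1)%N.
    apply: leq_trans (size_polyD _ _) _; rewrite geq_max sb andbT.
    exact: leq_trans (size_scale_leq _ _) sa.
  have B0 : zeta *: c + d != 0.
    by apply: contra_eq_neq Bt => ->; rewrite horner0 eq_sym oner_eq0.
  have [|mu [AE BE]] := match_form om0 sQ Qz sA B0.
    move=> l l1; have := fE l (cd _ l1); rewrite hornerZ => ->.
    by rewrite /lin_frac !hornerE [a.[l] * _]mulrC [c.[l] * _]mulrC.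
  have Qt : Q.[tau] != 0 by apply: Qz; rewrite t1.
  have muE : mu = Q.[tau]^-1.
    by move: Bt; rewrite BE hornerZ => /(canRL (mulfK Qt)) ->; rewrite mul1r.
  have Nt : - om * kappa * (revp n Q).[tau] = (om * (y tau).2 - (y tau).1.1) * q.[tau].
    have oo : om * om^* = 1 by rewrite -normCK om1 expr1n.
    rewrite /Q revpB revpZ hornerD hornerN hornerZ /y /=.
    transitivity (kappa * (om * (revp n q).[tau] - om * om^* * (revp n E).[tau])); first by ring.
    by rewrite oo; field.
  have Dt : Q.[tau] = (om * (y tau).1.2 - 1) * q.[tau].
    by rewrite /Q hornerD hornerN hornerZ /y /=; field.
  have zE : zeta = (om * (y tau).2 - (y tau).1.1) * q.[tau] / Q.[tau].
    by rewrite -At AE hornerZ muE -Nt; ring.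
  have : c.[z] * zeta + d.[z] = Q.[z] / Q.[tau].
    have : (zeta *: c + d).[z] = Q.[z] / Q.[tau] by rewrite BE hornerZ muE mulrC.
    by rewrite hornerD hornerZ mulrC.
  rewrite zE => /(canRL (addKr _)) ->.
  have -> : om * (y tau).1.2 - 1 = Q.[tau] / q.[tau] by rewrite Dt mulfK.
  by field; rewrite Qt qt.
(* The two identities are the coefficient of [om] and the constant term in [key]. *)
have sep z : (y tau).2 * c.[z] + (y tau).1.2 * d.[z] = E.[z] / q.[tau] /\
    (y tau).1.1 * c.[z] + d.[z] = q.[z] / q.[tau].
  have ew := key w w1 Qw solw z; have ev := key v v1 Qv solv z.
  have vw0 : v - w != 0 by move: vw; rewrite inE subr_eq0.
  have e1 : (y tau).2 * c.[z] + (y tau).1.2 * d.[z] = E.[z] / q.[tau].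
    apply: (mulfI vw0); apply/eqP; rewrite -subr_eq0; apply/eqP.
    move/eqP: ew; rewrite -subr_eq0 => /eqP ew; move/eqP: ev; rewrite -subr_eq0 => /eqP ev.
    rewrite -[RHS](subrr 0) -{1}ev -ew !(hornerD, hornerN, hornerZ); ring.
  split=> //.
  move/eqP: ew; rewrite -subr_eq0 => /eqP ew.
  transitivity (q.[z] / q.[tau] + w * ((y tau).2 * c.[z] + (y tau).1.2 * d.[z] - E.[z] / q.[tau])).
    apply/eqP; rewrite -subr_eq0 -oppr_eq0 -[X in _ == X]ew; apply/eqP.
    by rewrite !(hornerD, hornerN, hornerZ); ring.
  by rewrite e1 subrr mulr0 addr0.
move=> j; have [-> ->] := sep (sigma j).
have [q0 -> _ _] := node_values hdata qz interp j.
by field; rewrite q0 qt.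
Qed.

End ForwardTheorem.

(** * From Blaschke to royal interpolation *)

Section Backward.
Variable R : realType.
Local Notation C := R[i].

Lemma affine_eq0 (z w u v : C) : z != w -> z * u + v = 0 -> w * u + v = 0 -> u = 0 /\ v = 0.
Proof.
move=> zw ez ew; have u0 : u = 0.
  apply: (mulfI (_ : z - w != 0)); rewrite ?subr_eq0 // mulr0 mulrBl.
  by rewrite -[z * u](addrK v) ez -[w * u](addrK v) ew subrr.
by split=> //; move: ez; rewrite u0 mulr0 add0r.
Qed.

Lemma small_avoid (L : seq R) (e : R) : 0 < e -> exists2 s, 0 < s < e & s \notin L.
Proof.
move=> e0; have [N Ne] : exists N : nat, e^-1 < N%:R.
  by exists (Num.truncn e^-1).+1; exact: truncnS_gt.
have [|m mN mL] := @injective_avoid _ (fun m => m.+1%:R^-1 : R) L N.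
  by move=> i j /invr_inj /eqP; rewrite eqr_nat eqSS => /eqP.
exists (m.+1%:R^-1) => //; rewrite invr_gt0 ltr0n /= invf_plt ?posrE ?ltr0n //.
by apply: lt_le_trans Ne _; rewrite ler_nat ltnW.
Qed.

(* If h changed sign, it would vanish on every segment of a family of parallel
   segments, hence infinitely often. *)
Lemma disc_constant_sign (h : C -> R) (Z : seq C) (z1 z2 : C) : continuous h ->
    (forall z, disc z -> h z = 0 -> z \in Z) -> disc z1 -> disc z2 ->
  0 < h z1 -> ~ (h z2 < 0).
Proof.
move=> hc hZ D1 D2 h1 h2.
have z12 : z2 - z1 != 0.
  by rewrite subr_eq0; apply: contraTneq h1 => <-; rewrite -leNgt ltW.
(* [g s] runs along the segment from [z1] to [z2], shifted sideways by [s] times its length. *)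
pose g (s t : R) : C := z1 + (t%:C%C + 'i * s%:C%C) * (z2 - z1).
have gc t : continuous (g^~ t).
  move=> s; apply: (cvgD (F := nbhs s)); first exact: cvg_cst.
  apply: (cvgM (F := nbhs s)); last exact: cvg_cst.
  apply: (cvgD (F := nbhs s)); first exact: cvg_cst.
  apply: (cvgM (F := nbhs s)); first exact: cvg_cst.
  exact: (@continuous_real_complex R s).
have gc' s : continuous (g s).
  move=> t; apply: (cvgD (F := nbhs t)); first exact: cvg_cst.
  apply: (cvgM (F := nbhs t)); last exact: cvg_cst.
  apply: (cvgD (F := nbhs t)); last exact: cvg_cst.
  exact: (@continuous_real_complex R t).
have g0 : g 0 0 = z1 by rewrite /g (_ : (0%:C)%C = 0) // mulr0 addr0 mul0r addr0.
have g1 : g 0 1 = z2.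
  by rewrite /g (_ : (0%:C)%C = 0) // (_ : (1%:C)%C = 1) // mulr0 addr0 mul1r addrC subrK.
have cD (t : R) : disc (g 0 t) -> \forall s \near (0 : R), disc (g s t).
  rewrite /disc /= => gD; have cn := continuous_comp (gc t 0) (@continuous_normc R _).
  have lt1 : complex.Re `|g 0 t| < 1 by rewrite -ltcR -norm_ReE.
  have := cvgr_lt (FF := nbhs_filter (0 : R)) _ cn _ lt1.
  by apply: filterS => s /= s1; rewrite norm_ReE (ltcR _ 1).
have n1 : \forall s \near (0 : R), 0 < h (g s 0).
  have cn := continuous_comp (gc 0 0) (hc _).
  by apply: (cvgr_gt (FF := nbhs_filter (0 : R)) _ cn); rewrite /= g0.
have n2 : \forall s \near (0 : R), h (g s 1) < 0.
  have cn := continuous_comp (gc 1 0) (hc _).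
  by apply: (cvgr_lt (FF := nbhs_filter (0 : R)) _ cn); rewrite /= g1.
have n3 : \forall s \near (0 : R), disc (g s 0) by apply: cD; rewrite g0.
have n4 : \forall s \near (0 : R), disc (g s 1) by apply: cD; rewrite g1.
have : nbhs (0 : R) (fun s =>
    ((0 < h (g s 0)) /\ (h (g s 1) < 0)) /\ (disc (g s 0) /\ disc (g s 1))).
  exact: filterI (filterI n1 n2) (filterI n3 n4).
move=> /nbhs_ballP[e /= e0 be].
(* Every point [z] of the shifted segment satisfies [Im ((z - z1) / (z2 - z1)) = s], so this choice
   of [s] keeps the segment clear of [Z]. *)
have [s /andP[s0 se] sL] := small_avoid [seq complex.Im ((z - z1) / (z2 - z1)) | z <- Z] e0.
have [[/= hs0 hs1] [gs0 gs1]] :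
    ((0 < h (g s 0)) /\ (h (g s 1) < 0)) /\ (disc (g s 0) /\ disc (g s 1)).
  by apply: be; rewrite /ball /= sub0r normrN gtr0_norm.
have [||t tI ht] := @IVT R (fun t => h (g s t)) 0 1 0 ler01.
- apply: continuous_subspaceT => t; exact: (continuous_comp (gc' s t) (hc _)).
- by rewrite ge_min le_max (ltW hs1) (ltW hs0) orbT.
move/negP: sL; apply; apply/mapP; exists (g s t).
  apply: hZ ht; have -> : g s t = (1 - t)%:C%C * g s 0 + t%:C%C * g s 1.
    by rewrite /g rmorphB /= (_ : (0%:C)%C = 0) // (_ : (1%:C)%C = 1) //; ring.
  move: tI; rewrite in_itv /= => /andP[t0 t1].
  have nR (r : R) : 0 <= r -> `|r%:C%C : C| = r%:C%C.
    by move=> r0; rewrite normc_def /= expr0n addr0 sqrtr_sqr ger0_norm.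
  rewrite /disc /=; apply: le_lt_trans (ler_normD _ _) _.
  rewrite !normrM !nR ?subr_ge0 //.
  move: gs0 gs1; rewrite /disc /= (norm_ReE (g s 0)) (norm_ReE (g s 1)).
  move: (complex.Re _) (complex.Re _) => y x; rewrite !(ltcR _ 1) => x1 y1.
  rewrite -!rmorphM -rmorphD (ltcR _ 1) -subr_gt0.
  have -> : 1 - ((1 - t) * x + t * y) = (1 - t) * (1 - x) + t * (1 - y) by ring.
  have [t2|t2] := ltP 0 t.
    by rewrite ltr_wpDl ?mulr_ge0 ?mulr_gt0 ?subr_ge0 ?subr_gt0 // ltW.
  by rewrite ltr_wpDr ?mulr_ge0 ?mulr_gt0 ?subr_ge0 ?subr_gt0 ?(ltW y1) //; lra.
by rewrite /g addrC addKr mulfK // -complexiE /=; ring.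
Qed.

End Backward.

(** * The structure of a normalized parametrization *)

Section Parametrization.
Variable R : realType.
Local Notation C := R[i].
Variables (n k : nat) (hkn : (k <= n)%N).
Variables (sigma eta : 'I_n -> C) (rho : 'I_k -> R).
Hypothesis hdata : blaschke_data sigma eta rho.
Variables (a b c d : {poly C}) (tau : C) (L : seq C).
Hypotheses (sa : (size a <= n.+1)%N) (sb : (size b <= n.+1)%N).
Hypotheses (sc : (size c <= n.+1)%N) (sd : (size d <= n.+1)%N).
Hypothesis sol : forall zeta : C, `|zeta| = 1 -> zeta \notin L ->
  blaschke_solution hkn sigma eta rho (lin_frac a b c d zeta).
Hypothesis t1 : `|tau| = 1.
Hypotheses (ta : a.[tau] = 1) (tb : b.[tau] = 0) (tc : c.[tau] = 0) (td : d.[tau] = 1).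

Let cd (l : C) : `|l| = 1 -> closed_disc l.
Proof. by move=> l1; rewrite /closed_disc /= l1. Qed.

Lemma horner_affine (p q : {poly C}) (zeta z : C) : (zeta *: p + q).[z] = zeta * p.[z] + q.[z].
Proof. by rewrite hornerD hornerZ. Qed.

Lemma lin_frac_affine (zeta z : C) :
  lin_frac a b c d zeta z = (zeta *: a + b).[z] / (zeta *: c + d).[z].
Proof. by rewrite /lin_frac !horner_affine [a.[z] * _]mulrC [c.[z] * _]mulrC. Qed.

Lemma size_affine (p q : {poly C}) (zeta : C) : (size p <= n.+1)%N -> (size q <= n.+1)%N ->
  (size (zeta *: p + q)%R <= n.+1)%N.
Proof.
move=> sp sq; apply: leq_trans (size_polyD _ _) _; rewrite geq_max sq andbT.
exact: leq_trans (size_scale_leq _ _) sp.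
Qed.

Lemma two_parameters : exists zeta1 zeta2 : C, [/\ `|zeta1| = 1, `|zeta2| = 1,
  zeta1 \notin L, zeta2 \notin L & zeta1 != zeta2].
Proof.
have [z1 [n1 L1 _]] := @circle_avoid R L 1 1 (normr1 _) ltr01.
have [z2 [n2]] := @circle_avoid R (z1 :: L) 1 1 (normr1 _) ltr01.
rewrite inE negb_or => /andP[z21 L2] _; exists z1, z2; split=> //.
by rewrite eq_sym.
Qed.

(** Numerator and denominator are multiples of those of a Blaschke product, hence reversals of each
    other up to a scalar. Their values [zeta] and 1 at [tau] identify the scalar. *)
Lemma parametrization_form (zeta : C) : `|zeta| = 1 -> zeta \notin L ->
  zero_free (zeta *: c + d) /\
  zeta *: a + b = (zeta / tau ^+ n) *: revp n (zeta *: c + d).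
Proof.
move=> z1 zL; set A := zeta *: a + b; set B := zeta *: c + d.
have At : A.[tau] = zeta by rewrite horner_affine ta tb mulr1 addr0.
have Bt : B.[tau] = 1 by rewrite horner_affine tc td mulr0 add0r.
have B0 : B != 0 by apply: contra_eq_neq Bt => ->; rewrite horner0 eq_sym oner_eq0.
have [kappa [q [k1 sq qz fE]]] := blaschke_solution_form (sol z1 zL).
have k0 := unit_neq0 k1.
have [|mu [AE BE]] := match_form k0 sq qz (size_affine zeta sa sb) B0.
  by move=> l l1; rewrite -lin_frac_affine (fE _ (cd l1)).
have mu0 : mu != 0 by apply: contraNneq B0 => mu0; rewrite BE mu0 scale0r.
have muc0 : mu^* != 0 by rewrite conjC_eq0.
split; first by move=> z zD; rewrite BE hornerZ mulf_neq0 // qz.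
have AB : A = (mu * kappa / mu^*) *: revp n B.
  by rewrite BE revpZ scalerA divfK.
have tn0 : tau ^+ n != 0 by rewrite expf_neq0 // unit_neq0.
have zE : zeta = mu * kappa / mu^* * tau ^+ n.
  by rewrite -At {1}AB hornerZ horner_revp_circle ?size_affine // Bt conjC1 mulr1.
by rewrite {1}zE mulfK.
Qed.

(** Reversal conjugates [zeta], but the prefactor [zeta] absorbs this because [|zeta| = 1]. Both
    sides are then affine in [zeta], and two admissible values separate the coefficients. *)
Lemma parametrization_reverse : a = (tau ^+ n)^-1 *: revp n d /\ b = (tau ^+ n)^-1 *: revp n c.
Proof.
have [z1 [z2 [n1 n2 L1 L2 z12]]] := two_parameters.
have h z l : `|z| = 1 -> z \notin L -> z * (a - (tau ^+ n)^-1 *: revp n d).[l] +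
    (b - (tau ^+ n)^-1 *: revp n c).[l] = 0.
  move=> nz Lz; have [_ /(congr1 (fun p => p.[l]))] := parametrization_form nz Lz.
  rewrite horner_affine revpD revpZ !(hornerD, hornerN, hornerZ) => e.
  have zz : z * z^* = 1 by rewrite -normCK nz expr1n.
  transitivity (z * a.[l] + b.[l] - z / tau ^+ n * (revp n d).[l] -
    z * z^* / tau ^+ n * (revp n c).[l]); first by rewrite zz; ring.
  by rewrite e; ring.
split; apply/eqP; rewrite -subr_eq0; apply/eqP; apply: poly_eq_circle => l _.
  by have [-> _] := affine_eq0 z12 (h _ l n1 L1) (h _ l n2 L2); rewrite horner0.
by have [_ ->] := affine_eq0 z12 (h _ l n1 L1) (h _ l n2 L2); rewrite horner0.
Qed.

Lemma parametrization_no_common_root z : closed_disc z -> c.[z] = 0 -> d.[z] != 0.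
Proof.
move=> zD cz; have [z1 [_ [n1 _ L1 _ _]]] := two_parameters.
by have [/(_ z zD)] := parametrization_form n1 L1; rewrite horner_affine cz mulr0 add0r.
Qed.

(** A point of the disc with [|c| = |d|] is a zero of [zeta *: c + d] for the unimodular
    [zeta = - d / c], which must belong to [L]; hence it is a root of [G]. This leaves finitely many
    such points, and [disc_constant_sign] applies. *)
Lemma parametrization_le z : closed_disc z -> `|c.[z]| <= `|d.[z]|.
Proof.
rewrite le_norm_ReE; move: z; set h := fun z : C => complex.Re `|c.[z]| - complex.Re `|d.[z]|.
have hc : continuous h by exact: continuous_normB.
pose G := \prod_(zeta <- L) (zeta *: c + d).
have G0 : G != 0.
  rewrite prodf_seq_neq0; apply/allP => zeta _ /=.
  apply/eqP => /(congr1 (fun p => p.[tau])) /eqP.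
  by rewrite horner_affine tc td mulr0 add0r horner0 oner_eq0.
have [Z GZ] : exists Z : seq C, forall z, root G z -> z \in Z.
  have [Z GZ] := closed_field_poly_normal G; exists Z => z.
  by rewrite GZ rootZ ?lead_coef_eq0 // root_prod_XsubC.
have hZ z : disc z -> h z = 0 -> z \in Z.
  move=> zD /subr0_eq e; have {}zD : closed_disc z by exact: ltW.
  have {}e : `|c.[z]| = `|d.[z]| by rewrite norm_ReE e -norm_ReE.
  have cz : c.[z] != 0.
    apply/eqP => cz; have := parametrization_no_common_root zD cz.
    by rewrite -normr_eq0 -e cz normr0 eqxx.
  pose zeta := - d.[z] / c.[z].
  have Bz : (zeta *: c + d).[z] = 0 by rewrite horner_affine divfK // addNr.
  have z1 : `|zeta| = 1 by rewrite normf_div normrN -e divff // normr_eq0.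
  apply: GZ; rewrite /root horner_prod prodf_seq_eq0; apply/hasP.
  exists zeta; last by rewrite Bz eqxx.
  apply/negPn/negP => zL; have [/(_ z zD)] := parametrization_form z1 zL.
  by rewrite Bz eqxx.
(* By continuity a function nonnegative on the open disc would be nonnegative at [tau], where [h] is
   -1. *)
have [z2 D2 h2] : exists2 z2, disc z2 & h z2 < 0.
  apply: contrapT => no.
  have : 1 <= 0 :> R.
    have cN : continuous (fun z : C => complex.Re `|d.[z]| - complex.Re `|c.[z]|).
      exact: continuous_normB.
    have := closed_disc_le cN _ (cd t1); rewrite tc td normr0 normr1 subr0; apply => z zD.
    by rewrite -oppr_ge0 opprB leNgt; apply/negP => hz; apply: no; exists z.
  by rewrite ler10.
apply: closed_disc_le => // z1 D1; rewrite leNgt; apply/negP => h1.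
exact: (disc_constant_sign hc hZ D1 D2 h1 h2).
Qed.

(** For fixed [z] both sides are continuous in [zeta], so the exceptional parameters follow from the
    density of the others on the circle. *)
Lemma parametrization_contractive (zeta z : C) : `|zeta| = 1 -> disc z ->
  `|zeta * a.[z] + b.[z]| <= `|zeta * c.[z] + d.[z]|.
Proof.
move=> z1 zD; rewrite le_norm_ReE.
have E (p q : {poly C}) (w : C) : w * p.[z] + q.[z] = (p.[z] *: 'X + q.[z]%:P).[w].
  by rewrite hornerD hornerZ hornerX hornerC mulrC.
rewrite !E; move: zeta z1; apply: (circle_cofinite_le (E := L)); first exact: continuous_normB.
move=> w w1 wL; rewrite -le_norm_ReE -!E -!horner_affine.
have [Bz _] := parametrization_form w1 wL.
have [[_ le1 _ _] _ _ _] := sol w1 wL.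
have := le1 z zD; rewrite lin_frac_affine normf_div ler_pdivrMr ?mul1r //.
by rewrite normr_gt0 Bz //; exact: ltW.
Qed.

Lemma parametrization_node j :
  a.[sigma j] = eta j * c.[sigma j] /\ b.[sigma j] = eta j * d.[sigma j].
Proof.
have [z1 [z2 [n1 n2 L1 L2 z12]]] := two_parameters.
have sD : closed_disc (sigma j).
  have [_ _ h _ _] := hdata; have := h j; rewrite /closed_disc /=.
  by case: ifP => _ => [->|/ltW].
have h z : `|z| = 1 -> z \notin L -> z * (a.[sigma j] - eta j * c.[sigma j]) +
    (b.[sigma j] - eta j * d.[sigma j]) = 0.
  move=> nz Lz; have [_ _ + _] := sol nz Lz => /(_ j).
  have [Bz _] := parametrization_form nz Lz.
  rewrite lin_frac_affine => /(canRL (divfK (Bz _ sD))); rewrite !horner_affine => e.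
  by apply/eqP; rewrite mulrBr addrACA e -opprD subr_eq0; apply/eqP; ring.
have [/subr0_eq -> /subr0_eq ->] := affine_eq0 z12 (h _ n1 L1) (h _ n2 L2).
by [].
Qed.

(** For a solution [A / B] with [A = e * B] at the node, the phasar condition becomes
    [s (A' - e B') = rho e B]. This is linear in the pair [A], [B], hence affine in [zeta], and
    passes to the coefficients. *)
Lemma parametrization_phasar (i : 'I_k) : let s := sigma (widen_ord hkn i) in
  let e := eta (widen_ord hkn i) in
  s * (a^`().[s] - e * c^`().[s]) = (rho i)%:C%C * e * c.[s] /\
  s * (b^`().[s] - e * d^`().[s]) = (rho i)%:C%C * e * d.[s].
Proof.
move=> s e; have [z1 [z2 [n1 n2 L1 L2 z12]]] := two_parameters.
have [_ _ hs he _] := hdata.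
have s1 : `|s| = 1 by have := hs (widen_ord hkn i); rewrite /= ltn_ord.
have e1 : `|e| = 1 by have := he (widen_ord hkn i); rewrite /= ltn_ord.
have [as_ bs] := parametrization_node (widen_ord hkn i); rewrite -/s -/e in as_ bs.
have h z : `|z| = 1 -> z \notin L ->
    z * (s * (a^`().[s] - e * c^`().[s]) - (rho i)%:C%C * e * c.[s]) +
    (s * (b^`().[s] - e * d^`().[s]) - (rho i)%:C%C * e * d.[s]) = 0.
  move=> nz Lz; have [Bz ABE] := parametrization_form nz Lz.
  set A := z *: a + b in ABE; set B := z *: c + d in Bz ABE.
  have B0 : B.[s] != 0 by apply: Bz; rewrite s1.
  have As : A.[s] = e * B.[s] by rewrite /A /B !horner_affine as_ bs; ring.
  have A0 : A.[s] != 0 by rewrite As mulf_neq0 // unit_neq0.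
  have AB w : `|w| = 1 -> `|A.[w]| = `|B.[w]|.
    move=> w1; rewrite ABE hornerZ normrM normf_div normrX nz t1 expr1n divr1 mul1r.
    by rewrite norm_revp // size_affine.
  have [_ _ _ /(_ i)] := sol nz Lz.
  move=> /(@phasar_derivativeP R A B _ _ _ (fun w _ => lin_frac_affine z w) s1 A0 B0) LD.
  have AB' w : `|w| = 1 -> `|A.[w]| <= `|B.[w]| by move=> /AB ->.
  have LD' : log_derivative A B s = (rho i)%:C%C.
    by rewrite -LD RRe_real // (log_derivative_real AB' s1 (AB s s1)).
  have LE : s * (A^`().[s] - e * B^`().[s]) = (rho i)%:C%C * e * B.[s].
    rewrite -LD' /log_derivative As; field.
    by rewrite B0 unit_neq0.
  move: LE; rewrite /A /B !derivD !derivZ !horner_affine => /eqP.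
  by rewrite -subr_eq0 => /eqP LE; rewrite -LE; ring.
have [/subr0_eq -> /subr0_eq ->] := affine_eq0 z12 (h _ n1 L1) (h _ n2 L2).
by [].
Qed.

End Parametrization.

Section BackwardTheorem.
Variable R : realType.
Local Notation C := R[i].

Lemma circle_closed_disc (l : C) : `|l| = 1 -> closed_disc l.
Proof. by move=> l1; rewrite /closed_disc /= l1. Qed.

Lemma blaschke_to_royal (n k : nat) (hkn : (k <= n)%N)
    (sigma eta etat : 'I_n -> C) (rho : 'I_k -> R)
    (hdata : royal_data sigma eta etat rho) (a b c d : {poly C}) (x1 x2 x3 : C) :
  normalized_parametrization hkn sigma eta rho a b c d ->
  `|x3| = 1 -> `|x1| < 1 -> `|x2| < 1 -> x1 = x2^* * x3 ->
  (forall j : 'I_n, (x3 * c.[sigma j] + x2 * d.[sigma j]) /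
     (x1 * c.[sigma j] + d.[sigma j]) = etat j) ->
  exists x : C -> C * C * C, royal_solution hkn sigma eta etat rho x /\
     ~ (x @` @closed_disc R `<=` @royal_variety R).
Proof.
move=> [[sa sb sc sd] [L _ sol] [tau [t1 _ [ta tb tc td]]] _] n3 n1 n2 xE et.
have bdata := hdata.1.
have [aE bE] := parametrization_reverse sa sb sc sd sol t1 ta tb tc td.
have cdle z := parametrization_le sa sb sc sd sol t1 ta tb tc td (z := z).
have cd0 z := parametrization_no_common_root sa sb sc sd sol t1 ta tb tc td (z := z).
have x33 : x3 * x3^* = 1 by rewrite -normCK n3 expr1n.
have x1c : x3 * x1^* = x2 by rewrite xE rmorphM /= conjCK mulrCA x33 mulr1.
have tn0 : tau ^+ n != 0 by rewrite expf_neq0 // unit_neq0.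
pose q := x1 *: c + d; pose E := x3 *: c + x2 *: d; pose kappa := x3 / tau ^+ n.
have k1 : `|kappa| = 1 by rewrite normf_div normrX t1 expr1n divr1.
have qE z : q.[z] = x1 * c.[z] + d.[z] by rewrite hornerD hornerZ.
have EE z : E.[z] = x3 * c.[z] + x2 * d.[z] by rewrite hornerD !hornerZ.
have sq : (size q <= n.+1)%N by exact: size_affine.
have sE : (size E <= n.+1)%N.
  by apply: size_affine => //; exact: leq_trans (size_scale_leq _ _) sd.
have qz : zero_free q.
  move=> z zD; rewrite qE; apply/eqP => e.
  have dz : `|d.[z]| = `|x1| * `|c.[z]|.
    by move/eqP: e; rewrite addrC addr_eq0 => /eqP ->; rewrite normrN normrM.
  have cz : c.[z] != 0.
    by apply/eqP => cz; have := cd0 z zD cz; rewrite -normr_eq0 dz cz normr0 mulr0 eqxx.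
  have := cdle z zD; rewrite dz -[leLHS]mul1r ler_pM2r ?normr_gt0 //.
  by move=> /(lt_le_trans n1); rewrite ltxx.
have Eq z : closed_disc z -> `|E.[z]| <= `|q.[z]|.
  move=> zD; rewrite -(@ler_pXn2r _ 2) ?nnegrE // -subr_ge0.
  (* Since [x2] is [x3] times the conjugate of [x1], [E] is [x3] times [c + conj(x1) d], and this is
     the Schwarz-Pick identity for [c] and [d]. *)
  have -> : `|q.[z]| ^+ 2 - `|E.[z]| ^+ 2 = (1 - `|x1| ^+ 2) * (`|d.[z]| ^+ 2 - `|c.[z]| ^+ 2).
    rewrite qE EE -x1c !normCK !rmorphD !rmorphM /= conjCK.
    transitivity ((x1 * c.[z] + d.[z]) * (x1^* * (c.[z])^* + (d.[z])^*) -
      x3 * x3^* * (c.[z] + x1^* * d.[z]) * ((c.[z])^* + x1 * (d.[z])^*)); first by ring.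
    by rewrite x33; ring.
  apply: mulr_ge0; rewrite subr_ge0; first by rewrite expr_le1 // ltW.
  by rewrite ler_pXn2r ?nnegrE // cdle.
(* The first component of [x] is thus the parametrized fraction taken at the interior parameter [x1]
   in place of a unimodular [zeta]; this makes the node and phasar identities available for it. *)
have E1E z : kappa * (revp n E).[z] = x1 * a.[z] + b.[z].
  rewrite aE bE /E revpD !revpZ !(hornerD, hornerZ) /kappa.
  transitivity ((x2^* * x3) * ((tau ^+ n)^-1 * (revp n d).[z]) +
    x3 * x3^* * ((tau ^+ n)^-1 * (revp n c).[z])); first by ring.
  by rewrite x33 xE mul1r.
have NE z : kappa * (revp n q).[z] = x3 * a.[z] + x2 * b.[z].
  rewrite aE bE /q revpD revpZ !(hornerD, hornerZ) /kappa -x1c; ring.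
set x := tetra_map n kappa q E.
have xtb z : disc z -> closed_tetrablock (x z).
  move=> zD; have zcd : closed_disc z by exact: ltW.
  have q0 : q.[z] != 0 by exact: qz.
  apply: closed_tetrablockP => [|w w1].
    by rewrite /x /= normf_div ler_pdivrMr ?normr_gt0 // mul1r Eq.
  have -> : (x z).1.1 - (x z).2 * w = (x1 * a.[z] + b.[z] - (x3 * a.[z] + x2 * b.[z]) * w) / q.[z].
    by rewrite -E1E -NE /x /=; field.
  have -> : 1 - (x z).1.2 * w = (q.[z] - E.[z] * w) / q.[z] by rewrite /x /=; field.
  rewrite !normf_div ler_pM2r ?invr_gt0 ?normr_gt0 //.
  have xw : 1 - x2 * w != 0.
    rewrite subr_eq0; apply/eqP => e; have : `|x2 * w| < 1 by rewrite normrM w1 mulr1.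
    by rewrite -e normr1 ltxx.
  (* The tetrablock inequality at [w] is the contractivity of the parametrized fraction at this
     [zeta], multiplied by [1 - x2 w]; for [|w| = 1] the number [zeta] is unimodular. *)
  pose zeta := (x1 - x3 * w) / (1 - x2 * w).
  have zeta1 : `|zeta| = 1.
    have ww : w * w^* = 1 by rewrite -normCK w1 expr1n.
    rewrite normf_div (_ : x1 - x3 * w = - (x3 * w) * (1 - x2 * w)^*).
      by rewrite !normrM normrN norm_conjC normrM n3 w1 !mul1r divff // normr_eq0.
    rewrite rmorphB rmorphM /= conjC1 xE.
    transitivity (x2^* * x3 * (w * w^*) - x3 * w); first by rewrite ww mulr1.
    by ring.
  have -> : x1 * a.[z] + b.[z] - (x3 * a.[z] + x2 * b.[z]) * w =
      (zeta * a.[z] + b.[z]) * (1 - x2 * w) by rewrite /zeta; field.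
  have -> : q.[z] - E.[z] * w = (zeta * c.[z] + d.[z]) * (1 - x2 * w).
    by rewrite qE EE /zeta; field.
  rewrite (normrM (zeta * a.[z] + _)) (normrM (zeta * c.[z] + _)) ler_pM2r ?normr_gt0 //.
  exact: (parametrization_contractive sa sb sc sd sol t1 ta tb tc td zeta1 zD).
have [xi xd] := tetra_map_inner k1 qz sq sE (fun l l1 => Eq l (circle_closed_disc l1)) xtb.
have node j := parametrization_node bdata sa sb sc sd sol t1 ta tb tc td j.
have sD := node_closed_disc hdata.
exists x; split; last first.
  (* By the normalization [x tau] is the given point [(x1, x2, x3)], which is not royal because
     [|x1 x2| < 1 = |x3|]. *)
  have tD : closed_disc tau by rewrite /closed_disc /= t1.
  move=> /(_ (x tau)) [|_]; first by exists tau.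
  rewrite /x /= NE E1E qE EE ta tb tc td !(mulr0, mulr1, add0r, addr0) !divr1 => x3E.
  have : `|x1 * x2| < 1 by rewrite normrM mulr_ilt1.
  by rewrite -x3E n3 ltxx.
split=> //.
- move=> j; have q0 : q.[sigma j] != 0 by apply: qz; exact: sD.
  have [an bn] := node j.
  have eE : E.[sigma j] = etat j * q.[sigma j] by rewrite -et -EE -qE divfK.
  have e1 : kappa * (revp n E).[sigma j] = eta j * q.[sigma j] by rewrite E1E an bn qE; ring.
  have e3 : kappa * (revp n q).[sigma j] = eta j * E.[sigma j] by rewrite NE an bn EE; ring.
  by rewrite /x /tetra_map e1 e3 eE; congr (_, _, _); field.
- move=> i; have := parametrization_phasar hdata.1 sa sb sc sd sol t1 ta tb tc td i.
  set s := sigma _; set e := eta _ => -[pa pb].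
  have [an bn] := node (widen_ord hkn i); rewrite -/s -/e in an bn.
  have [_ _ hs he _] := bdata.
  have s1 : `|s| = 1 by have := hs (widen_ord hkn i); rewrite /= ltn_ord.
  have e1 : `|e| = 1 by have := he (widen_ord hkn i); rewrite /= ltn_ord.
  have q0 : q.[s] != 0 by apply: qz; rewrite s1.
  have e0 := unit_neq0 e1.
  pose p := x1 *: a + b.
  have pE z : p.[z] = x1 * a.[z] + b.[z] by rewrite hornerD hornerZ.
  have fE z : `|z| = 1 -> (x z).1.1 = p.[z] / q.[z] by move=> _; rewrite pE /x /= E1E.
  have ps : p.[s] = e * q.[s] by rewrite pE an bn qE; ring.
  apply/(@phasar_derivativeP R p q _ s _ fE s1 _ q0); first by rewrite ps mulf_neq0.
  suff -> : log_derivative p q s = (rho i)%:C%C by [].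
  have key : s * (p^`().[s] - e * q^`().[s]) = (rho i)%:C%C * e * q.[s].
    rewrite /p /q !derivD !derivZ !(hornerD, hornerZ).
    transitivity (x1 * (s * (a^`().[s] - e * c^`().[s])) + s * (b^`().[s] - e * d^`().[s])).
      by ring.
    by rewrite pa pb; ring.
  have eq0 : e * q.[s] != 0 by rewrite mulf_neq0.
  apply: (mulIf eq0); rewrite [RHS]mulrA -key /log_derivative ps; field.
  by rewrite q0 e0.
Qed.

End BackwardTheorem.

(* a, b, c, d : any fixed normalized parametrization of the solutions of the
   Blaschke problem (arbitrary polynomials if that problem has no solution). *)
Theorem theorem1p7 (R : realType) (n k : nat) (hkn : (k <= n)%N)
    (sigma eta etat : 'I_n -> R[i]) (rho : 'I_k -> R)
    (hdata : royal_data sigma eta etat rho)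
    (a b c d : {poly R[i]})
    (hparam : blaschke_solvable hkn sigma eta rho ->
              normalized_parametrization hkn sigma eta rho a b c d) :
  (exists x : R[i] -> R[i] * R[i] * R[i],
     royal_solution hkn sigma eta etat rho x /\
     ~ (x @` @closed_disc R `<=` @royal_variety R))
  <->
  (blaschke_solvable hkn sigma eta rho /\
   exists x1 x2 x3 : R[i],
     [/\ `|x3| = 1, `|x1| < 1, `|x2| < 1, x1 = x2^* * x3 &
         forall j : 'I_n,
           (x3 * c.[sigma j] + x2 * d.[sigma j]) /
           (x1 * c.[sigma j] + d.[sigma j]) = etat j]).
Proof.
split=> [[x [xr nr]]|[bs [x1 [x2 [x3 [n3 n1 n2 xE et]]]]]].
  exact: (royal_to_blaschke hdata hparam xr nr).
exact: (blaschke_to_royal hdata (hparam bs) n3 n1 n2 xE et).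
Qed.
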